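(* For all $i\in\mathcal I$, $\mathrm{HD}(\Omega_i)<\mathrm{HD}(\Omega_\infty)$.
   Context: Groups. Let $r\ge 2$, $\mathcal I=\{1,\dots,r\}$, and let $\Gamma_1,\dots,\Gamma_r$ be non-trivial finitely generated groups with identities $e_i$; the case $r=2=|\Gamma_1|=|\Gamma_2|$ is excluded. Put $\Gamma_i^\times=\Gamma_i\setminus\{e_i\}$. The free product $\Gamma=\Gamma_1\ast\dots\ast\Gamma_r$ is the set of words $x_1\dots x_n$ ($n\ge 1$, $x_j\in\bigcup_i\Gamma_i^\times$, consecutive letters not from the same $\Gamma_i$) together with the empty word $e$; each $\Gamma_i$ is regarded as a subset of $\Gamma$, with $e_i$ identified with $e$. For each $i$ let $S_i$ be a finite symmetric generating set of $\Gamma_i$ with $e_i\notin S_i$ (in the paper, the support of the step distribution $\mu_i$ of a random walk on $\Gamma_i$). $\mathcal X$ is the Cayley graph of $\Gamma$ with respect to $\bigcup_iS_i$, $\mathcal X_i$ the Cayley graph of $\Gamma_i$ with respect to $S_i$, and $l(x)$ is the graph distance in $\mathcal X$ from $e$ to $x$. Ends. A ray is a semi-infinite path without repeated vertices; two rays are equivalent if some third ray shares infinitely many vertices with each of them; ends are the equivalence classes. $\Omega$ is the set of ends of $\mathcal X$. $\Omega_i^{(0)}$ is the set of ends of $\mathcal X_i$ (regarded as ends of $\mathcal X$ via $\mathcal X_i\subseteq\mathcal X$), $\Omega_i=\{x\omega: x\in\Gamma,\ \omega\in\Omega_i^{(0)}\}$, where $x\omega$ is the translate of the end by $x$, and $\Omega_\infty$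 is the set of infinite words $x_1x_2\dots$ with $x_j\in\bigcup_i\Gamma_i^\times$ and consecutive letters not from the same $\Gamma_i$, identified with the ends they describe. For a finite vertex set $F$, the $\omega$-component of $\mathcal X\setminus F$ is the connected component containing all but finitely many vertices of every ray in $\omega$. Metric and Hausdorff dimension. Let $B_m=\{x\in\Gamma: l(x)\le m\}$, $B_{-1}=\emptyset$. For distinct $\omega_1,\omega_2\in\Omega$ let $c(\omega_1,\omega_2)$ be the maximal $m\in\{0,1,2,\dots\}$ such that the $\omega_1$- and $\omega_2$-components of $\mathcal X\setminus B_{m-1}$ coincide. Fix $\alpha\in(0,1)$; the metric on $\Omega$ is $d_\Omega(\omega_1,\omega_2)=\alpha^{c(\omega_1,\omega_2)}$ for $\omega_1\neq\omega_2$, and $d_\Omega(\omega,\omega)=0$. Balls $B(\omega,\varepsilon)$ are closed. For $\Omega'\subseteq\Omega$, a cover is a finite or countable family of balls with centers in $\Omega'$ and positive radii whose union contains $\Omega'$. $\mathcal H_\delta(\Omega')=\lim_{\varepsilon\downarrow0}\inf\{\sum_i\varepsilon_i^\delta:\{B(\cdot,\varepsilon_i)\}_i\text{ a cover of }\Omega'\text{ with all }\varepsilon_i<\varepsilon\}$ and $\mathrm{HD}(\Omega')=\inf\{\delta\ge0:\mathcal H_\delta(\Omega')=0\}$. *)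

(* Defs.v *)
From HB Require Import structures.
From mathcomp Require Import all_boot all_order all_algebra.
From mathcomp Require Import all_classical all_reals all_analysis.

Set Implicit Arguments.
Unset Strict Implicit.
Unset Printing Implicit Defensive.

Import Order.TTheory GRing.Theory Num.Theory.
Import numFieldNormedType.Exports.

Local Open Scope classical_set_scope.
Local Open Scope ring_scope.

Section FreeProduct.
Local Open Scope group_scope.
Variables (I : choiceType) (G : I -> groupType).

Definition letter := {i : I & G i}.

Implicit Types (a b : letter) (u v w : seq letter).

Definition reduced w :=
  all (fun a => tagged a != 1) w && sorted (fun a b => tag a != tag b) w.

(* Reduced form of the word [a :: w], for [w] reduced and any letter [a]. *)
Definition word_cons a w : seq letter :=
  if tagged a == 1 then w else
  if w isn't b :: w' then [:: a] else
  if tag a != tag b then a :: w else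
  let c := tagged a * tagged_as a b in
  if c == 1 then w' else Tagged G c :: w'.

Definition word_mul u v := foldr word_cons v u.

Definition word_inv w :=
  rev [seq Tagged G ((tagged a)^-1 : G (tag a)) | a <- w].

Lemma reduced_consE a w : reduced (a :: w) =
  [&& tagged a != 1, (if w is b :: _ then tag a != tag b else true)
    & reduced w].
Proof.
rewrite /reduced /=; case: w => [|b w] /=; first by rewrite !andbT.
by rewrite -!andbA; do !bool_congr.
Qed.

Lemma reduced_tl a w : reduced (a :: w) -> reduced w.
Proof. by rewrite reduced_consE => /and3P[]. Qed.

Lemma word_cons_reduced a w : reduced w -> reduced (word_cons a w).
Proof.
rewrite /word_cons; case: ifPn => // a1 rw.
case: w rw => [|b w] rw; first by rewrite reduced_consE a1.
case: ifPn => [ab|]; first by rewrite reduced_consE a1 ab.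
rewrite negbK => /eqP ab; case: ifPn => c1; first exact: reduced_tl rw.
by move: rw; rewrite !reduced_consE /= c1 ab => /and3P[_ -> ->].
Qed.

Lemma word_mul_reduced u v : reduced v -> reduced (word_mul u v).
Proof. by move=> rv; elim: u => //= a u; apply: word_cons_reduced. Qed.

Lemma word_consE a w : reduced (a :: w) -> word_cons a w = a :: w.
Proof.
rewrite reduced_consE /word_cons => /and3P[/negPf-> + _].
by case: w => // b w ->.
Qed.

Lemma word_cons1 i w : word_cons (Tagged G (1 : G i)) w = w.
Proof. by rewrite /word_cons eqxx. Qed.

Lemma word_consM i (g h : G i) w : reduced w ->
  word_cons (Tagged G g) (word_cons (Tagged G h) w) =
  word_cons (Tagged G (g * h)) w.
Proof.
move=> rw.
have [->|h1] := eqVneq h 1; first by rewrite word_cons1 mulg1.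
have [->|g1] := eqVneq g 1; first by rewrite word_cons1 mul1g.
case: w rw => [|[j k] w].
  by rewrite /word_cons /= (negPf h1) (negPf g1) /= eqxx /= tagged_asE.
have [ij|ij] := eqVneq i j; last first.
  move=> _; rewrite /word_cons /= (negPf h1) (negPf g1) /= ij /= eqxx /=.
  by rewrite tagged_asE.
case: j / ij k => k rw.
move: (rw); rewrite reduced_consE /= => /and3P[k1 hd rw'].
rewrite {2 3}/word_cons /= (negPf h1) eqxx /= !tagged_asE.
have [gh|gh] := eqVneq (g * h) 1.
  have [hk|hk] := eqVneq (h * k) 1.
    have -> : g = k by rewrite -[g]mulg1 -hk mulgA gh mul1g.
    by apply: word_consE; rewrite reduced_consE /= k1 hd.
  rewrite /word_cons /= (negPf g1) eqxx /= tagged_asE mulgA gh mul1g.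
  by rewrite (negPf k1).
have [hk|hk] := eqVneq (h * k) 1.
  rewrite -mulgA hk mulg1 (negPf g1).
  by apply: word_consE; rewrite reduced_consE /= g1 hd.
by rewrite /word_cons /= (negPf g1) eqxx /= tagged_asE mulgA.
Qed.

Lemma word_cons_mul a u v : reduced u -> reduced v ->
  word_mul (word_cons a u) v = word_cons a (word_mul u v).
Proof.
move=> ru rv; case: a => i g.
have [->|g1] := eqVneq g 1; first by rewrite !word_cons1.
rewrite {1}/word_cons /= (negPf g1); case: u ru => [|[j h] u] ru //=.
have [ij|ij] //= := eqVneq i j.
case: j / ij h ru => h ru; rewrite tagged_asE.
rewrite word_consM ?word_mul_reduced//.
by have [->|//] := eqVneq (g * h) 1; rewrite word_cons1.
Qed.

Lemma word_mulA u v w : reduced u -> reduced v -> reduced w ->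
  word_mul u (word_mul v w) = word_mul (word_mul u v) w.
Proof.
move=> ru rv rw; elim: u ru => //= a u IHu ru.
by rewrite IHu ?(reduced_tl ru)// word_cons_mul// word_mul_reduced.
Qed.

Lemma word_mulw0 w : reduced w -> word_mul w [::] = w.
Proof.
elim: w => //= a w IHw raw.
by rewrite IHw ?word_consE// (reduced_tl raw).
Qed.

Lemma word_inv_reduced w : reduced w -> reduced (word_inv w).
Proof.
rewrite /reduced /word_inv all_rev all_map rev_sorted sorted_map.
move=> /andP[w1 sw]; apply/andP; split.
  by apply: sub_all w1 => a /=; rewrite invg_eq1.
by apply: sub_sorted sw => a b /=; rewrite eq_sym.
Qed.

Lemma word_mulV w : reduced w -> word_mul (word_inv w) w = [::].
Proof.
elim: w => //= -[i g] w IHw raw.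
rewrite /word_inv /= rev_cons -cats1 /word_mul foldr_cat /=.
rewrite -(word_consE raw) word_consM ?(reduced_tl raw)//.
by rewrite mulVg word_cons1; apply/IHw/(reduced_tl raw).
Qed.

Lemma word_invK w : word_inv (word_inv w) = w.
Proof.
rewrite /word_inv map_rev revK -map_comp -[RHS]map_id.
by apply: eq_map => -[i g] /=; rewrite invgK.
Qed.

Definition free_product := {w : seq letter | reduced w}.

HB.instance Definition _ := Choice.on free_product.

Definition fp1 : free_product := exist _ [::] isT.

Definition fp_mul (x y : free_product) : free_product :=
  exist _ (word_mul (val x) (val y))
    (word_mul_reduced (val x) (valP y)).

Definition fp_inv (x : free_product) : free_product :=
  exist _ (word_inv (val x)) (word_inv_reduced (valP x)).

Lemma fp_mulA : associative fp_mul.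
Proof. by move=> x y z; apply/val_inj/word_mulA; apply: valP. Qed.

Lemma fp_mul1 : left_id fp1 fp_mul.
Proof. by move=> x; apply: val_inj. Qed.

Lemma fp_mulx1 : right_id fp1 fp_mul.
Proof. by move=> x; apply/val_inj/word_mulw0/valP. Qed.

Lemma fp_mulV : left_inverse fp1 fp_inv fp_mul.
Proof. by move=> x; apply/val_inj/word_mulV/valP. Qed.

Lemma fp_mulxV : right_inverse fp1 fp_inv fp_mul.
Proof.
move=> x; apply: val_inj => /=; rewrite -{1}(word_invK (val x)).
exact/word_mulV/word_inv_reduced/valP.
Qed.

HB.instance Definition _ := isGroup.Build free_product
  fp_mulA fp_mul1 fp_mulx1 fp_mulV fp_mulxV.

Lemma fp_inj_reduced i (g : G i) : reduced (word_cons (Tagged G g) [::]).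
Proof. exact: word_cons_reduced. Qed.

(* The embedding of [G i]: the one-letter word [g], or the empty word if
   [g = 1]. *)
Definition fp_inj i (g : G i) : free_product :=
  exist _ (word_cons (Tagged G g) [::]) (fp_inj_reduced g).

Definition infinite_word (x : nat -> letter) :=
  (forall n, tagged (x n) != 1) /\ (forall n, tag (x n) != tag (x n.+1)).

End FreeProduct.

Section Groups.
Local Open Scope group_scope.
Variable G : groupType.

Definition generates (S : set G) := forall x : G,
  exists2 s : seq G, (forall y, y \in s -> S y) & x = \prod_(y <- s) y.

Definition cayley (S : set G) (x y : G) : Prop := exists2 s, S s & y = x * s.

End Groups.

Section Graphs.
Variables (V : Type) (E : V -> V -> Prop).
Implicit Types (U F C : set V) (p q : nat -> V).

Definition walk_in U (x y : V) (n : nat) (p : nat -> V) :=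
  [/\ p 0%N = x, p n = y, forall k, (k <= n)%N -> U (p k)
    & forall k, (k < n)%N -> E (p k) (p k.+1)].

(* Graph distance; the value is 0 if [x] and [y] are not connected. *)
Definition gdist (x y : V) : nat :=
  xget 0%N [set n | (exists p, walk_in setT x y n p) /\
    forall k, (exists p, walk_in setT x y k p) -> (n <= k)%N].

Definition component U C :=
  exists2 x, U x & C = [set y | exists n p, walk_in U x y n p].

Definition ray p := injective p /\ forall n, E (p n) (p n.+1).

Definition ray_equiv p q := exists2 s, ray s &
  infinite_set (range s `&` range p) /\ infinite_set (range s `&` range q).

Definition is_end (w : set (nat -> V)) :=
  exists2 p, ray p & w = [set q | ray q /\ ray_equiv p q].

Record end_ := End { rays : set (nat -> V) ; raysP : is_end rays }.

(* [C] is the [w]-component of the graph with the vertices in [F] removed.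
   Rays being injective, "all but finitely many vertices" can be counted by
   indices. *)
Definition end_component F (w : end_) C :=
  component (~` F) C /\
  forall p, rays w p -> finite_set [set n | ~ C (p n)].

(* The ball [B_(m-1)] around [o]; it is empty for [m = 0]. *)
Definition ball_pred (o : V) (m : nat) : set V :=
  [set x | (gdist o x < m)%N].

Definition same_component (o : V) (w1 w2 : end_) (m : nat) := exists2 C,
  end_component (ball_pred o m) w1 C & end_component (ball_pred o m) w2 C.

(* The largest [m] such that [same_component o w1 w2 m] (0 if there is
   none). *)
Definition confluent (o : V) (w1 w2 : end_) : nat :=
  xget 0%N [set m | same_component o w1 w2 m /\
    forall k, same_component o w1 w2 k -> (k <= m)%N].

Definition end_dist (R : realType) (alpha : R) (o : V) (w1 w2 : end_) : R :=
  if `[< w1 = w2 >] then 0 else alpha ^+ confluent o w1 w2.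

End Graphs.

Section Hausdorff.
Variables (R : realType) (T : Type) (d : T -> T -> R).

(* Finite or countable families are indexed by an arbitrary [countType]. *)
Definition ball_cover (A : set T) (eps : R) (K : countType)
    (c : K -> T) (e : K -> R) :=
  [/\ forall k, A (c k), forall k, 0 < e k < eps &
      A `<=` \bigcup_(k in [set: K]) [set y | d (c k) y <= e k]].

Definition hausdorff_pre (delta : R) (A : set T) (eps : R) : \bar R :=
  ereal_inf [set s | exists (K : countType) (c : K -> T) (e : K -> R),
    ball_cover A eps c e /\ s = (\esum_(k in [set: K]) (e k `^ delta)%:E)%E].

Definition hausdorff_measure (delta : R) (A : set T) : \bar R :=
  lim (hausdorff_pre delta A eps @[eps --> 0^'+]).

Definition hausdorff_dim (A : set T) : \bar R :=
  ereal_inf [set delta%:E | delta in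
    [set delta : R | 0 <= delta /\ hausdorff_measure delta A = 0%E]].

End Hausdorff.

Section EndsOfFreeProduct.
Local Open Scope group_scope.
Variables (r : nat) (G : 'I_r -> groupType) (S : forall i, set (G i)).

Definition fp_gens : set (free_product G) :=
  \bigcup_(i in [set: 'I_r]) (@fp_inj _ G i @` @S i).

Definition fp_graph : free_product G -> free_product G -> Prop :=
  cayley fp_gens.

Definition fp_end := end_ fp_graph.

(* Ends of the Cayley graph of [G i], as ends of the Cayley graph of the free
   product: [w] contains the images of the rays of [w0]. *)
Definition Omega0 (i : 'I_r) : set fp_end :=
  [set w | exists w0 : end_ (cayley (@S i)),
    forall p, rays w0 p -> rays w (fun n => fp_inj (p n))].

Definition Omega (i : 'I_r) : set fp_end :=
  [set w | exists x w0, Omega0 i w0 /\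
    rays w = [set (fun n => x * p n) | p in rays w0]].

(* The end described by the infinite word [x] is the class of the rays passing
   through all the prefixes of [x]. *)
Definition Omega_infty : set fp_end :=
  [set w | exists2 x, infinite_word x &
    exists2 p, rays w p & forall n, exists k, val (p k) = mkseq x n].

Definition fp_end_dist (R : realType) (alpha : R) : fp_end -> fp_end -> R :=
  end_dist alpha (1 : free_product G).

End EndsOfFreeProduct.

Arguments Omega {r G} S i.
Arguments Omega_infty {r G} S.
Arguments fp_end_dist {r G} S {R} alpha.

(* Main.v *)
Require Import Defs.
From HB Require Import structures.
From mathcomp Require Import all_boot all_order all_algebra.
From mathcomp Require Import all_classical all_reals all_analysis.
From mathcomp Require Import finmap zify.

Import Order.TTheory GRing.Theory Num.Theory.
Import numFieldNormedType.Exports.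

Set Implicit Arguments.
Unset Strict Implicit.
Unset Printing Implicit Defensive.

Local Open Scope classical_set_scope.
Local Open Scope ring_scope.

(* Let s(m) be the number of elements of Gamma_i of length m.
   Upper bound: an end of x Gamma_i has a ray which, outside the ball of radius
   m - 1, is connected to some x h with h in Gamma_i of length m + |x|, so
   s(m + |x|) balls of radius alpha^m cover these ends.  As s is
   submultiplicative, HD(Omega_i) <= delta as soon as
   s(m) alpha^(delta m) < 1 for some m > 0.  Let D be the infimum of these
   delta.
   Lower bound: for a finite set F of letters and a letter y of another factor,
   the words a_0 y a_1 y ... with a_j in F form a Cantor set in Omega_infty:
   the prefixes are cut vertices, so a ball meeting the set lies in a cylinder
   of comparable weight, and HD(Omega_infty) >= delta as soon as
   sum_(a in F) alpha^(delta (|a| + |y|)) >= 1.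
   If s vanishes somewhere then HD(Omega_i) <= 0, and two letters in F suffice
   for a positive lower bound.  Otherwise s(m) alpha^(D m) >= 1 for all m > 0,
   so the sum over the elements of length 1, ..., N exceeds 1 at delta = D for
   large N, hence also at some delta > D. *)

(** * Rays, ends and connectivity at infinity *)

Lemma finite_nat_bounded (A : set nat) : finite_set A ->
  exists N, forall n, A n -> (n < N)%N.
Proof.
move=> /finite_seqP[s ->]; exists (\max_(i <- s) i).+1 => n /= ns.
by rewrite ltnS; apply: (@leq_bigmax_seq _ s xpredT id n).
Qed.

Lemma injective_leaves_finite (T : Type) (p : nat -> T) (F : set T) :
  injective p -> finite_set F -> exists N, forall n, (N <= n)%N -> ~ F (p n).
Proof.
move=> pinj finF.
have [|N HN] := @finite_nat_bounded (p @^-1` F).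
  by apply: finite_preimage => // x y _ _; apply: pinj.
by exists N => n Nn Fn; move: (HN n Fn); rewrite ltnNge Nn.
Qed.

Lemma injective_infinite (T : Type) (p : nat -> T) (A : set T) :
  injective p -> (forall n, A (p n)) -> infinite_set A.
Proof.
move=> pinj pA finA; have [N /(_ N (leqnn N))] :=
  injective_leaves_finite pinj finA.
by apply; apply: pA.
Qed.

Lemma infinite_setDn (T : Type) (A B : set T) :
  infinite_set A -> finite_set B -> exists x, A x /\ ~ B x.
Proof.
move=> infA finB; apply: contrapT => h; apply: infA.
apply: sub_finite_set finB => x Ax; apply: contrapT => Bx.
by apply: h; exists x.
Qed.

Section Connectivity.
Variables (V : choiceType) (E : V -> V -> Prop).
Hypothesis Esym : forall x y, E x y -> E y x.
Implicit Types (U F C : set V) (p q : nat -> V).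

Definition conn U x y := exists n p, walk_in E U x y n p.

(** Sequences give access to concatenation, shortening and splitting of paths. The path relation
    tests only the target of each edge, so [U x] is stated apart. *)
Lemma conn_pathP U x y : conn U x y <->
  U x /\ exists2 s, path (fun a b => `[< E a b /\ U b >]) x s & last x s = y.
Proof.
split=> [[n [p [p0 pn Up Ep]]]|[Ux [s ps <-]]].
  split; first by rewrite -p0; apply: Up.
  exists (mkseq (fun k => p k.+1) n).
    apply/(pathP x) => i; rewrite size_mkseq => ltin.
    apply/asboolP; rewrite nth_mkseq//; split; last exact: Up.
    case: i ltin => [|i] ltin /=; first by rewrite -p0; apply: Ep.
    by rewrite nth_mkseq ?(ltnW ltin)//; apply: Ep.
  case: n pn {Up Ep} => [|n] pn; first by rewrite /= -pn p0.
  by rewrite (last_nth x) size_mkseq /= nth_mkseq.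
exists (size s), (nth x (x :: s)); split => //.
- by rewrite -last_nth.
- case=> [|k] // ks; have /asboolP[] := pathP x ps k ks; tauto.
- by move=> k ks; have /asboolP[] := pathP x ps k ks.
Qed.

Lemma conn_in U x y : conn U x y -> U x /\ U y.
Proof. by case=> n [p [<- <- h _]]; split; apply: h. Qed.

Lemma conn_refl U x : U x -> conn U x x.
Proof. by move=> Ux; apply/conn_pathP; split=> //; exists [::]. Qed.

Lemma conn_edge U x y : U x -> U y -> E x y -> conn U x y.
Proof.
move=> Ux Uy Exy; apply/conn_pathP; split=> //; exists [:: y] => //=.
by rewrite andbT; apply/asboolP.
Qed.

Lemma conn_trans U x y z : conn U x y -> conn U y z -> conn U x z.
Proof.
move=> /conn_pathP[Ux [s ps <-]] /conn_pathP[_ [t pt <-]].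
by apply/conn_pathP; split=> //; exists (s ++ t); rewrite ?cat_path ?ps ?last_cat.
Qed.

Lemma conn_ind U (Q : V -> Prop) x y : conn U x y ->
  (forall a b, U a -> U b -> E a b -> Q a -> Q b) -> Q x -> Q y.
Proof.
move=> /conn_pathP[Ux [s ps <-]] h; elim: s x Ux ps => //= a s IH x Ux.
move=> /andP[/asboolP[Exa Ua] ps] Qx.
by apply: IH => //; apply: h Qx.
Qed.

Lemma conn_sym U x y : conn U x y -> conn U y x.
Proof.
move=> cxy; have [Ux _] := conn_in cxy.
apply: (conn_ind cxy (Q := fun z => conn U z x)); last exact: conn_refl.
by move=> a b Ua Ub Eab; apply: conn_trans; apply: conn_edge => //; apply: Esym.
Qed.

Lemma conn_sub U U' x y : U `<=` U' -> conn U x y -> conn U' x y.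
Proof.
move=> sub cxy; have [Ux _] := conn_in cxy.
apply: (conn_ind cxy (Q := conn U' x)); last exact/conn_refl/sub.
move=> a b Ua Ub Eab ca; apply: conn_trans ca _.
by apply: conn_edge => //; apply: sub.
Qed.

Lemma conn_tail U p N i : (forall n, E (p n) (p n.+1)) ->
  (forall n, (N <= n)%N -> U (p n)) -> (N <= i)%N -> conn U (p N) (p i).
Proof.
move=> Ep Up; elim: i => [|i IH] Ni.
  by move: Ni; rewrite leqn0 => /eqP N0; rewrite N0; apply/conn_refl/Up; rewrite N0.
move: (Ni); rewrite leq_eqVlt => /orP[/eqP <-|].
  exact/conn_refl/Up.
rewrite ltnS => Ni'; apply: conn_trans (IH Ni') _.
by apply: conn_edge => //; apply: Up.
Qed.

(** For rays and [U] the complement of a finite set, the tails of [p] and [q] lie in the same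
    component of [U]; asking for arbitrarily late connected pairs avoids naming that component. *)
Definition tail_conn U p q := forall N, exists i j,
  [/\ (N <= i)%N, (N <= j)%N & conn U (p i) (q j)].

Lemma tail_conn_sub U U' p q : U `<=` U' -> tail_conn U p q ->
  tail_conn U' p q.
Proof.
by move=> sub h N; have [i [j [*]]] := h N; exists i, j; split=> //;
  apply: conn_sub sub _.
Qed.

Lemma tail_conn_sym U p q : tail_conn U p q -> tail_conn U q p.
Proof.
by move=> h N; have [i [j [*]]] := h N; exists j, i; split=> //; apply: conn_sym.
Qed.

Lemma tail_conn_trans F p q t : ray E q -> finite_set F ->
  tail_conn (~` F) p q -> tail_conn (~` F) q t -> tail_conn (~` F) p t.
Proof.
move=> [qinj Eq] finF pq qt N.
have [M qM] := injective_leaves_finite qinj finF.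
have [i [j [Ni Mj c1]]] := pq (maxn M N).
have [k [l [Mk Nl c2]]] := qt (maxn M N).
move: Ni Mj Mk Nl; rewrite !geq_max => /andP[_ Ni] /andP[Mj _] /andP[Mk _] /andP[_ Nl].
exists i, l; split=> //; apply: conn_trans c1 (conn_trans _ c2).
by apply: conn_trans (conn_sym _) (conn_tail (N := M) _ _ _);
  try exact: (conn_tail (N := M)).
Qed.

Lemma tail_conn_ray F p : ray E p -> finite_set F -> tail_conn (~` F) p p.
Proof.
move=> [pinj Ep] finF N; have [M pM] := injective_leaves_finite pinj finF.
exists (maxn M N), (maxn M N); rewrite leq_maxr; split=> //.
by apply: conn_refl; apply: pM; rewrite leq_maxl.
Qed.

(** The third ray meets [p] and [q] arbitrarily late, and its own tail avoids [F], so a segment of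
    that tail is the required connection. *)
Lemma ray_equiv_tail_conn F p q : ray E p -> ray E q -> ray_equiv E p q ->
  finite_set F -> tail_conn (~` F) p q.
Proof.
move=> rp rq [s [sinj Es] [isp isq]] finF N.
have [M sM] := injective_leaves_finite sinj finF.
have meet t : infinite_set (range s `&` range t) ->
    exists i k, [/\ (N <= i)%N, (M <= k)%N & t i = s k].
  move=> ist.
  have [|x [[[k _ <-] [i _ ti]] nx]] := infinite_setDn ist
      (B := (t @` `I_N) `|` (s @` `I_M)).
    by rewrite finite_setU; split; apply: finite_image; apply: finite_II.
  exists i, k; split=> //; rewrite leqNgt; apply/negP => lt; apply: nx.
    by left; exists i.
  by right; exists k.
have [i [k [Ni Mk pi]]] := meet p isp.
have [j [l [Nj Ml qj]]] := meet q isq.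
exists i, j; rewrite pi qj; split=> //.
by apply: conn_trans (conn_sym (conn_tail (N := M) _ _ _))
  (conn_tail (N := M) _ _ _).
Qed.

(* Such a path can be continued along [p], whose remainder it does not meet. *)
Definition stops_on p x t :=
  [/\ path (fun a b => `[< E a b >]) x t, uniq (x :: t) &
    exists a, last x t = p a /\ forall k, p k \in x :: t -> (k <= a)%N].

(** The vertices of [x :: t] are deleted. Past the endpoint [p] is untouched, so it can be followed
    and then left for a late vertex of [q] without meeting the old path. *)
Lemma stops_on_switch p q x t : ray E p -> ray E q ->
  (forall F, finite_set F -> tail_conn (~` F) p q) ->
  stops_on p x t -> exists u, u <> [::] /\ stops_on q x (t ++ u).
Proof.
move=> [pinj Ep] [qinj Eq] pq [pt ut [a [ta amax]]].
have finF : finite_set [set` x :: t] by apply: finite_seq.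
have [N qN] := injective_leaves_finite qinj finF.
have [i [j [ai Nj pqij]]] := pq _ finF (maxn N a.+1).
move: ai Nj; rewrite !geq_max => /andP[_ ai] /andP[Nj _].
have : conn (~` [set` x :: t]) (p a.+1) (q j).
  apply: conn_trans (conn_tail Ep _ ai) pqij => n an /amax.
  by rewrite leqNgt an.
move=> /conn_pathP[pa [s ps sq]].
move: sq; case/shortenP: ps => s' ps' us' _ sq.
have finG : finite_set [set` p a.+1 :: s'] by apply: finite_seq.
have [M qM] := injective_leaves_finite qinj finG.
have exb : exists k, q k \in p a.+1 :: s'.
  by exists j; rewrite -sq; apply: mem_last.
have ubb k : q k \in p a.+1 :: s' -> (k <= M)%N.
  by move=> qk; rewrite leqNgt; apply/negP => Mk; apply: (qM k (ltnW Mk)).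
(* Cutting the new path at its vertex of largest index on [q] keeps the rest of [q] unvisited;
   vertices of [q] on the old path have index below [N <= j <= b]. *)
have [b qb bmax] := ex_maxnP exb ubb.
case/splitPl: s' / qb ps' us' sq bmax {exb ubb finG qM} => s1 s2 s1b.
rewrite cat_path -cat_cons cat_uniq => /andP[ps1 _] /andP[us1 _] sq bmax.
have s1F : all (fun b => ~~ (b \in x :: t)) (p a.+1 :: s1).
  move: pa ps1 => /negP pa ps1; rewrite /= pa /=.
  elim: (s1) (p a.+1) ps1 => //= c l IH d /andP[/asboolP[_ /negP cF] /IH ->].
  by rewrite cF.
exists (p a.+1 :: s1); split=> //; split.
- rewrite cat_path pt /= ta; apply/andP; split; first exact/asboolP.
  by apply: sub_path ps1 => c d /asboolP[Ecd _]; apply/asboolP.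
- by rewrite -cat_cons cat_uniq ut us1 andbT -all_predC.
- exists b; rewrite last_cat /= -s1b; split=> // k.
  rewrite -cat_cons mem_cat => /orP[kF|ks].
    have kN : (k < N)%N.
      by rewrite ltnNge; apply/negP => Nk; apply: (qN k Nk).
    apply: leq_trans (ltnW kN) (leq_trans Nj _); apply: bmax.
    by rewrite -sq; apply: mem_last.
  by apply: bmax; rewrite mem_cat ks.
Qed.

(* The two rays are woven into a third one by switching infinitely often
   between them. *)
Lemma tail_conn_ray_equiv p q : ray E p -> ray E q ->
  (forall F, finite_set F -> tail_conn (~` F) p q) -> ray_equiv E p q.
Proof.
move=> rp rq pq; pose pr (b : bool) := if b then q else p; pose x := p 0%N.
have rpr b : ray E (pr b) by case: b.
have prC b F : finite_set F -> tail_conn (~` F) (pr b) (pr (~~ b)).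
  by move=> finF; case: b; [apply: tail_conn_sym|]; apply: pq.
have /choice[h hP] : forall bt : bool * seq V, exists u,
    stops_on (pr bt.1) x bt.2 ->
    u <> [::] /\ stops_on (pr (~~ bt.1)) x (bt.2 ++ u).
  move=> [b t] /=; have [st|st] := pselect (stops_on (pr b) x t).
    by have [u] := stops_on_switch (rpr b) (rpr (~~ b)) (prC b) st; exists u.
  by exists [::].
(* Stage [n] stops on [p] for even [n] and on [q] for odd [n]; each stage prolongs the previous one
   by a nonempty piece. *)
pose tt := fix tt n := if n is n'.+1 then tt n' ++ h (odd n', tt n') else [::].
have ttP n : stops_on (pr (odd n)) x (tt n).
  elim: n => [|n IH] /=.
    split=> //; exists 0%N; split=> // k; rewrite inE => /eqP.
    by move/(proj1 rp) => ->.
  by have [_] := hP (odd n, tt n) IH.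
have tt_cat n m : (n <= m)%N -> exists u, tt m = tt n ++ u.
  elim: m => [|m IH]; first by rewrite leqn0 => /eqP ->; exists [::].
  rewrite leq_eqVlt => /orP[/eqP ->|]; first by exists [::]; rewrite cats0.
  by rewrite ltnS => /IH[u /= ->]; eexists; rewrite -catA.
have tt_size n : (size (tt n) < size (tt n.+1))%N.
  rewrite /= size_cat -[X in (X < _)%N]addn0 ltn_add2l.
  by have [/= + _] := hP (odd n, tt n) (ttP n); case: (h _).
have tt_gt n : (n <= size (tt n))%N.
  by elim: n => // n IH; apply: leq_ltn_trans IH (tt_size n).
(* Stage [n] has at least [n] edges, so its [n]-th vertex is final and the limit path can be read
   along the diagonal. *)
pose s n := nth x (x :: tt n) n.
have sE m n : (n <= size (tt m))%N -> s n = nth x (x :: tt m) n.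
  move=> nm; rewrite /s; have [le|/ltnW le] := leqP m n.
    have [u ->] := tt_cat _ _ le.
    by rewrite -cat_cons nth_cat /= ltnS nm.
  have [u ->] := tt_cat _ _ le.
  by rewrite -cat_cons nth_cat /= ltnS tt_gt.
have sinj : injective s.
  move=> i j; rewrite (sE (maxn i j)) ?(leq_trans (leq_maxl i j))//.
  rewrite (sE (maxn i j)) ?(leq_trans (leq_maxr i j))//.
  have [_ ut _] := ttP (maxn i j); move/eqP; rewrite nth_uniq ?ltnS//=.
  - by move/eqP.
  - exact: leq_trans (leq_maxl i j) _.
  - exact: leq_trans (leq_maxr i j) _.
have Es n : E (s n) (s n.+1).
  have [pt _ _] := ttP n.+1.
  have := pathP x pt n (tt_gt n.+1); move/asboolP.
  by rewrite -(sE n.+1 n) ?(leq_trans (leqnSn _) (tt_gt _))// -[nth _ _ _]/(s n.+1).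
have stt n : exists a, s (size (tt n)) = pr (odd n) a.
  have [_ _ [a [ta _]]] := ttP n; exists a.
  by rewrite (sE n)// -last_nth.
have sz_lt : {homo (fun n => size (tt n)) : m n / (m < n)%N}.
  by apply: homo_ltn => //; apply: ltn_trans.
(* The stages [b + n.*2] have the parity of [b]; their endpoints are distinct vertices of [pr b]. *)
have meet b : infinite_set (range s `&` range (pr b)).
  apply: (injective_infinite (p := fun n => s (size (tt (b + n.*2)%N)))).
    move=> m n /sinj E0; have [lt|lt|//] := ltngtP m n.
      have := @sz_lt (b + m.*2)%N (b + n.*2)%N.
      by rewrite ltn_add2l ltn_double lt E0 ltnn => /(_ isT).
    have := @sz_lt (b + n.*2)%N (b + m.*2)%N.
    by rewrite ltn_add2l ltn_double lt E0 ltnn => /(_ isT).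
  move=> n; split; first by exists (size (tt (b + n.*2)%N)).
  have [a] := stt (b + n.*2)%N; rewrite oddD odd_double addbF oddb => ->.
  by exists a.
by exists s; split=> //; [apply: (meet false)|apply: (meet true)].
Qed.

Lemma ray_equivP p q : ray E p -> ray E q -> ray_equiv E p q <->
  forall F, finite_set F -> tail_conn (~` F) p q.
Proof.
move=> rp rq; split=> [pq F|]; first exact: ray_equiv_tail_conn.
exact: tail_conn_ray_equiv.
Qed.

Implicit Types w : end_ E.

Lemma rays_ray w p : rays w p -> ray E p.
Proof. by case: w => w /= [q rq ->] []. Qed.

Lemma rays_tail_conn w p q F : rays w p -> rays w q -> finite_set F ->
  tail_conn (~` F) p q.
Proof.
case: w => w /= [t rt ->] [rp /ray_equivP tp] [rq /ray_equivP tq] finF.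
apply: (tail_conn_trans rt finF); last exact: tq.
by apply: tail_conn_sym; apply: tp.
Qed.

(** Equality of the records themselves is what [end_dist] tests: the sets of rays coincide, and the
    proof fields agree by irrelevance. *)
Lemma rays_eq w1 w2 p q : rays w1 p -> rays w2 q ->
  (forall F, finite_set F -> tail_conn (~` F) p q) -> w1 = w2.
Proof.
move=> w1p w2q pq.
have sub w w' t t' : rays w t -> rays w' t' ->
    (forall F, finite_set F -> tail_conn (~` F) t t') -> rays w `<=` rays w'.
  move=> wt wt' tt' u wu; have ru := rays_ray wu.
  case: w' wt' => w' /= [v rv ->] [rt' /ray_equivP vt'].
  split=> //; apply/ray_equivP => // F finF.
  apply: (tail_conn_trans rt' finF); first exact: vt'.
  apply: (tail_conn_trans (rays_ray wt) finF); last exact: rays_tail_conn wt wu finF.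
  by apply: tail_conn_sym; apply: tt'.
have : rays w1 = rays w2.
  apply/seteqP; split; first exact: sub pq.
  by apply: sub w2q w1p _ => F finF; apply: tail_conn_sym; apply: pq.
case: w1 w2 {w1p w2q} => [w1 P1] [w2 P2] /= e.
by case: _ / e P2 => P2; congr End; apply: Prop_irrelevance.
Qed.

Definition class_of_ray p (rp : ray E p) : end_ E :=
  End (ex_intro2 _ _ p rp (erefl [set q | ray E q /\ ray_equiv E p q])).

Lemma class_of_rayP p (rp : ray E p) : rays (class_of_ray rp) p.
Proof.
by split=> //; apply/ray_equivP => // F; apply: tail_conn_ray.
Qed.

Lemma rays_nonempty w : exists p, rays w p.
Proof.
have [p rp e] := raysP w; exists p; rewrite e.
exact: (class_of_rayP rp).
Qed.

Lemma component_conn U C x y : component E U C -> C x -> C y -> conn U x y.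
Proof. by move=> [z _ ->] zx zy; apply: conn_trans (conn_sym zx) zy. Qed.

Lemma end_component_tail F w C p : end_component F w C -> rays w p ->
  exists N, forall n, (N <= n)%N -> C (p n).
Proof.
move=> [_ /(_ p)] h /h /finite_nat_bounded[N HN]; exists N => n Nn.
by apply: contrapT => /HN; rewrite ltnNge Nn.
Qed.

(** Beyond some [N] the ray [p] avoids [F]; the common component is that of [p N], in which every
    ray of either end has a tail. *)
Lemma same_componentP F w1 w2 p q : finite_set F -> rays w1 p -> rays w2 q ->
  (exists2 C, end_component F w1 C & end_component F w2 C) <->
  tail_conn (~` F) p q.
Proof.
move=> finF w1p w2q; split=> [[C C1 C2] N|pq].
  have [N1 H1] := end_component_tail C1 w1p.
  have [N2 H2] := end_component_tail C2 w2q.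
  exists (maxn N1 N), (maxn N2 N); rewrite !leq_maxr; split=> //.
  by apply: component_conn (proj1 C1) (H1 _ _) (H2 _ _); rewrite leq_maxl.
have [pinj Ep] := rays_ray w1p.
have [N pN] := injective_leaves_finite pinj finF.
have tail w u : rays w u -> tail_conn (~` F) p u ->
    finite_set [set n | ~ conn (~` F) (p N) (u n)].
  move=> wu pu; have [uinj Eu] := rays_ray wu.
  have [M uM] := injective_leaves_finite uinj finF.
  have [i [j [+ + cij]]] := pu (maxn N M).
  rewrite !geq_max => /andP[Ni _] /andP[_ Mj].
  apply: sub_finite_set (finite_II M) => n /= nc.
  rewrite ltnNge; apply/negP => Mn; apply: nc.
  apply: conn_trans (conn_trans (conn_tail (N := N) _ _ Ni) cij) _ => //.
  by apply: conn_trans (conn_sym (conn_tail (N := M) _ _ _)) (conn_tail (N := M) _ _ _).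
exists [set y | conn (~` F) (p N) y].
  split; first by exists (p N); first exact: pN.
  by move=> u wu; apply: (tail w1) => //; apply: rays_tail_conn wu finF.
split; first by exists (p N); first exact: pN.
move=> u wu; apply: (tail w2) => //.
by apply: tail_conn_trans (rays_ray w2q) finF pq (rays_tail_conn w2q wu finF).
Qed.

End Connectivity.

(** * Confluence and Cayley graphs *)

Section Confluence.
Variables (V : choiceType) (E : V -> V -> Prop) (o : V).
Hypothesis Esym : forall x y, E x y -> E y x.
Hypothesis ball_fin : forall m, finite_set (ball_pred E o m).

Lemma ball_pred_sub m n : (m <= n)%N -> ball_pred E o m `<=` ball_pred E o n.
Proof. by move=> mn x xm; apply: leq_trans xm mn. Qed.

Lemma finite_sub_ball F : finite_set F -> exists m, F `<=` ball_pred E o m.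
Proof.
move=> /(finite_image (gdist E o)) /finite_nat_bounded[m Fm].
by exists m => x Fx; apply: Fm; exists x.
Qed.

Lemma same_ball_componentP m (w1 w2 : end_ E) p q : rays w1 p -> rays w2 q ->
  same_component o w1 w2 m <-> tail_conn E (~` ball_pred E o m) p q.
Proof. exact: same_componentP. Qed.

(** The maximum in [confluent] exists, so the default of [xget] is not reached: distinct ends are
    separated by a finite set, and a ball containing that set separates them too. *)
Lemma le_confluent m (w1 w2 : end_ E) : w1 <> w2 -> same_component o w1 w2 m ->
  (m <= confluent o w1 w2)%N /\ same_component o w1 w2 (confluent o w1 w2).
Proof.
have [[p w1p] [q w2q]] := (rays_nonempty Esym w1, rays_nonempty Esym w2).
move=> ne scm.
have [F [finF nF]] : exists F, finite_set F /\ ~ tail_conn E (~` F) p q.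
  apply: contrapT => h; apply: ne; apply: rays_eq w1p w2q _ => // F finF.
  by apply: contrapT => nt; apply: h; exists F.
have [M FM] := finite_sub_ball finF.
have ub k : same_component o w1 w2 k -> (k <= M)%N.
  move=> /(same_ball_componentP _ w1p w2q) tk; rewrite leqNgt; apply/negP => Mk.
  apply: nF; apply: tail_conn_sub tk; apply: subsetC.
  exact: subset_trans FM (ball_pred_sub (ltnW Mk)).
pose P k := `[< same_component o w1 w2 k >].
have exP : exists k, P k by exists m; apply/asboolP.
have ubP k : P k -> (k <= M)%N by move=> /asboolP; apply: ub.
have [n /asboolP nP nmax] := ex_maxnP exP ubP.
have : exists n, same_component o w1 w2 n /\
    forall k, same_component o w1 w2 k -> (k <= n)%N.
  by exists n; split=> // k sk; apply: nmax; apply/asboolP.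
rewrite /confluent; case: xgetP => [k _ [sk kmax] _|h [k sk]].
  by split=> //; apply: kmax.
by case: (h k).
Qed.

Variables (R : realType) (alpha : R).
Hypothesis alpha01 : 0 < alpha < 1.

Lemma end_dist_le m (w1 w2 : end_ E) p q : rays w1 p -> rays w2 q ->
  tail_conn E (~` ball_pred E o m) p q -> end_dist alpha o w1 w2 <= alpha ^+ m.
Proof.
move=> w1p w2q pq; have /andP[a0 a1] := alpha01.
rewrite /end_dist; case: asboolP => [_|ne]; first exact/exprn_ge0/ltW.
have [|mc _] := @le_confluent m _ _ ne; first exact/(same_ball_componentP _ w1p w2q).
by rewrite ler_wiXn2l ?(ltW a0)// ltW.
Qed.

Lemma end_dist_lt m (w1 w2 : end_ E) p q : rays w1 p -> rays w2 q ->
  end_dist alpha o w1 w2 < alpha ^+ m ->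
  tail_conn E (~` ball_pred E o m.+1) p q.
Proof.
move=> w1p w2q; have /andP[a0 a1] := alpha01.
rewrite /end_dist; case: asboolP => [w12 _|ne].
  move: w1p; rewrite w12 => w2p.
  exact: (rays_tail_conn Esym w2p w2q (ball_fin _)).
rewrite ltr_iXn2l// => mc.
apply: (@tail_conn_sub _ _ (~` ball_pred E o (confluent o w1 w2))).
  exact/subsetC/ball_pred_sub.
apply/(same_ball_componentP _ w1p w2q).
(* A positive value cannot be the default 0 of [xget], so it has the defining property. *)
have : (0 < confluent o w1 w2)%N by apply: leq_trans mc.
by rewrite /confluent; case: xgetP => // k _ [].
Qed.

End Confluence.

(** * Word length in a finitely generated group *)

Section Cayley.
Local Open Scope group_scope.
Variables (H : groupType) (T : set H).
Hypothesis Tgen : generates T.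
Notation E := (cayley T).
Implicit Types (x y : H) (s : seq H).

Definition word_length x := gdist E 1 x.

Lemma cayley_walkP x y n : (exists p, walk_in E setT x y n p) <->
  exists s, [/\ size s = n, forall z, z \in s -> T z & y = x * \prod_(z <- s) z].
Proof.
split=> [[p [<- <- _ Ep]]|[s [<- sT ->]]].
  elim: n Ep => [|n IH] Ep.
    by exists [::]; rewrite big_nil mulg1.
  have [k kn|s [sn sT pn]] := IH; first by apply: Ep; apply: ltnW.
  have [z Tz pz] := Ep n (ltnSn n).
  exists (rcons s z); split; first by rewrite size_rcons sn.
    by move=> t; rewrite mem_rcons inE => /orP[/eqP ->|/sT].
  by rewrite big_rcons /= pz pn mulgA.
exists (fun k => x * \prod_(z <- take k s) z); split=> //.
- by rewrite take0 big_nil mulg1.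
- by rewrite take_size.
- move=> k ks; exists (nth 1 s k); first by apply: sT; apply: mem_nth.
  by rewrite (take_nth 1)// big_rcons mulgA.
Qed.

Lemma word_length_le s : (forall z, z \in s -> T z) ->
  (word_length (\prod_(z <- s) z) <= size s)%N.
Proof.
move=> sT; have ex : exists p, walk_in E setT 1 (\prod_(z <- s) z) (size s) p.
  by apply/cayley_walkP; exists s; rewrite mul1g.
rewrite /word_length /gdist; case: xgetP => // n _ [_]; exact.
Qed.

Lemma word_lengthP x : exists s,
  [/\ size s = word_length x, forall z, z \in s -> T z & x = \prod_(z <- s) z].
Proof.
suff /cayley_walkP[s [*]] : exists p, walk_in E setT 1 x (word_length x) p.
  by exists s; split=> //; rewrite -[RHS]mul1g.
pose P n := `[< exists p, walk_in E setT 1 x n p >].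
have exP : exists n, P n.
  have [s sT xE] := Tgen x; exists (size s); apply/asboolP/cayley_walkP.
  by exists s; rewrite mul1g.
have [n /asboolP nP nmin] := ex_minnP exP.
rewrite /word_length /gdist; case: xgetP => [k _ []//|h].
case: (h n); split=> // k wk; apply: nmin; exact/asboolP.
Qed.

Lemma word_length1 : word_length 1 = 0%N.
Proof. by have := @word_length_le [::]; rewrite big_nil leqn0 => /(_ _)/eqP; apply. Qed.

Lemma word_length_gt0 x : x != 1 -> (0 < word_length x)%N.
Proof.
rewrite lt0n; apply: contraNneq => x0; have [s [+ _ ->]] := word_lengthP x.
by rewrite x0 => /size0nil ->; rewrite big_nil.
Qed.

Lemma word_lengthM x y :
  (word_length (x * y) <= word_length x + word_length y)%N.
Proof.
have [s [<- sT ->]] := word_lengthP x; have [t [<- tT ->]] := word_lengthP y.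
rewrite -big_cat -size_cat; apply: word_length_le => z.
by rewrite mem_cat => /orP[/sT|/tT].
Qed.

Lemma word_length_gen z : T z -> (word_length z <= 1)%N.
Proof.
move=> Tz; have := @word_length_le [:: z]; rewrite big_seq1; apply=> t.
by rewrite inE => /eqP ->.
Qed.

Hypothesis Tfin : finite_set T.

Lemma finite_cayley_ball m : finite_set (ball_pred E 1 m).
Proof.
elim: m => [|m IH].
  by rewrite (_ : ball_pred _ _ _ = set0)//; apply/seteqP; split.
apply: (@sub_finite_set _ _ ([set 1] `|` [set x * z | x in ball_pred E 1 m & z in T])).
  move=> x /=; rewrite /ball_pred /= ltnS -/(word_length x) => xm.
  have [s [ss sT xE]] := word_lengthP x.
  case/lastP: s ss sT xE => [|s z] ss sT xE; first by left; rewrite xE big_nil.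
  right; rewrite big_rcons in xE; exists (\prod_(z <- s) z).
    rewrite /ball_pred /= -/(word_length _); apply: leq_ltn_trans (word_length_le _) _.
      by move=> t ts; apply: sT; rewrite mem_rcons inE ts orbT.
    by move: xm; rewrite -ss size_rcons.
  by exists z => //; apply: sT; rewrite mem_rcons inE eqxx.
by rewrite finite_setU; split; [apply: finite_set1|apply: finite_image2].
Qed.

Hypothesis Tsym : forall x, T x -> T x^-1.

Lemma cayley_sym x y : E x y -> E y x.
Proof. by move=> [z Tz ->]; exists z^-1; [apply: Tsym|rewrite mulgK]. Qed.

End Cayley.

(** * Free products *)

Section FreeProductWords.
Local Open Scope group_scope.
Variables (I : choiceType) (G : I -> groupType).
Implicit Types (a b : letter G) (u v w t : seq (letter G)).

Lemma word_mul_cat u v : reduced (u ++ v) -> word_mul u v = u ++ v.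
Proof.
elim: u => //= a u IH ru.
by rewrite IH ?(reduced_tl ru)// word_consE.
Qed.

Lemma word_cons_neq a w : tagged a != 1 ->
  (if w is b :: _ then tag a != tag b else true) -> word_cons a w = a :: w.
Proof. by rewrite /word_cons => /negPf ->; case: w => // b w ->. Qed.

(* A letter on the right only interferes with the last letter of a word. *)
Lemma word_mul_letter_head b t a : reduced (b :: t) ->
  word_mul (b :: t) (word_cons a [::]) = [::] \/
  exists c z, word_mul (b :: t) (word_cons a [::]) = c :: z /\ tag c = tag b.
Proof.
move: {2 3}(word_mul _ _) (erefl (word_mul (b :: t) (word_cons a [::]))) => z.
elim: t b z => [|c t IH] b z /= <-; rewrite reduced_consE => /and3P[b1 bc rct].
  have [a1|a1] := eqVneq (tagged a) 1.
    rewrite [word_cons a _]/word_cons a1 eqxx.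
    by rewrite word_cons_neq//; right; exists b, [::].
  rewrite [word_cons a _]word_cons_neq// /word_cons (negPf b1); case: ifP => ab.
    by right; exists b, [:: a].
  by case: ifP => _; [left|right; eexists _, [::]].
have [/= ->|[d [z' [/= -> dc]]]] := IH c _ erefl rct.
  by rewrite word_cons_neq//; right; exists b, [::].
by rewrite word_cons_neq ?dc//; right; exists b, (d :: z').
Qed.

Lemma word_mul_letter u t a : reduced (u ++ t) -> t <> [::] ->
  word_mul (u ++ t) (word_cons a [::]) =
  u ++ word_mul t (word_cons a [::]).
Proof.
case: t => // b t; elim: u => // c u IH /= rcu _.
move: (rcu); rewrite reduced_consE => /and3P[c1 cu ru].
rewrite IH// word_cons_neq//.
case: u {IH rcu} cu ru => //= cu ru.
by have [/= ->|[d [z' [/= -> ->]]]] := word_mul_letter_head a ru.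
Qed.

(** [tagged_as] falls back on its first argument when the tags differ, so letters of other factors
    go to 1. Extended to words, this is the retraction of the free product onto [G i]. *)
Definition letter_proj i a : G i := tagged_as (Tagged G (1 : G i)) a.

Lemma letter_proj_eq i (g : G i) : letter_proj i (Tagged G g) = g.
Proof. by rewrite /letter_proj tagged_asE. Qed.

Lemma letter_proj_neq i a : i != tag a -> letter_proj i a = 1.
Proof. by rewrite /letter_proj /tagged_as; case: eqP. Qed.

Lemma letter_projM i j (g h : G j) : letter_proj i (Tagged G (g * h)) =
  letter_proj i (Tagged G g) * letter_proj i (Tagged G h).
Proof.
have [ij|ij] := eqVneq i j; last by rewrite !letter_proj_neq// mulg1.
by case: j / ij g h => g h; rewrite !letter_proj_eq.
Qed.

Lemma letter_proj1 i j : letter_proj i (Tagged G (1 : G j)) = 1.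
Proof.
have [ij|ij] := eqVneq i j; last by rewrite letter_proj_neq.
by case: j / ij; rewrite letter_proj_eq.
Qed.

Definition word_proj i w : G i := \prod_(a <- w) letter_proj i a.

Lemma word_proj_cons i a w :
  word_proj i (word_cons a w) = letter_proj i a * word_proj i w.
Proof.
rewrite /word_proj /word_cons; case: a => j g /=; case: eqP => [->|_].
  by rewrite letter_proj1 mul1g.
case: w => [|[k h] w] /=; first by rewrite big_seq1 big_nil mulg1.
have [jk|jk] /= := eqVneq j k; last by rewrite !big_cons.
case: k / jk h => h; rewrite tagged_asE big_cons mulgA -letter_projM.
case: eqP => [->|_]; last by rewrite big_cons.
by rewrite letter_proj1 mul1g.
Qed.

Definition fp_proj i (x : free_product G) : G i := word_proj i (val x).

Lemma fp_projM i x y : fp_proj i (x * y) = fp_proj i x * fp_proj i y.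
Proof.
rewrite /fp_proj /=; elim: (val x) => [|a u IH] /=.
  by rewrite {2}/word_proj big_nil mul1g.
by rewrite word_proj_cons IH mulgA {3}/word_proj big_cons.
Qed.

Lemma fp_proj_inj i j (g : G j) :
  fp_proj i (fp_inj g) = letter_proj i (Tagged G g).
Proof.
by rewrite /fp_proj /= word_proj_cons /word_proj big_nil mulg1.
Qed.

Lemma fp_injM i (g h : G i) : fp_inj (g * h) = fp_inj g * fp_inj h.
Proof.
apply: val_inj; rewrite /= -word_consM//.
have [->|g1] := eqVneq g 1; first by rewrite !word_cons1.
by rewrite [in RHS](word_cons_neq (a := Tagged G g)).
Qed.

Lemma fp_inj1 i : fp_inj (1 : G i) = 1.
Proof. by apply: val_inj; rewrite /= word_cons1. Qed.

Lemma fp_injK i : cancel (@fp_inj I G i) (fp_proj i).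
Proof. by move=> g; rewrite fp_proj_inj letter_proj_eq. Qed.

Lemma fp_injV i (g : G i) : fp_inj g^-1 = (fp_inj g)^-1.
Proof.
by apply: (mulgI (fp_inj g)); rewrite -fp_injM !mulgV fp_inj1.
Qed.

End FreeProductWords.

(** * Word metric of the free product and spheres in a factor *)

Section FreeProductGraph.
Local Open Scope group_scope.
Variables (r : nat) (G : 'I_r -> groupType) (S : forall i, set (G i)).
Hypothesis S_finite : forall i, finite_set (@S i).
Hypothesis S_sym : forall i (x : G i), S x -> S x^-1.
Hypothesis S_generates : forall i, generates (@S i).
Notation gens := (fp_gens S).
Notation FP := (free_product G).
Notation len := (word_length gens).
Implicit Types (u v w : seq (letter G)) (x y : FP).

Lemma fp_gens_finite : finite_set gens.
Proof.
apply: bigcup_finite => [|i _]; first exact: finite_finset.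
exact: finite_image.
Qed.

Lemma fp_gens_sym x : gens x -> gens x^-1.
Proof.
by move=> [i _ [s Ss <-]]; exists i => //; exists s^-1; [apply: S_sym|rewrite fp_injV].
Qed.

Lemma fp_inj_prod i (s : seq (G i)) :
  fp_inj (\prod_(g <- s) g) = \prod_(g <- s) fp_inj g.
Proof. by apply: big_morph; [apply: fp_injM|apply: fp_inj1]. Qed.

Lemma val_fp_inj_mul a w (raw : reduced (a :: w)) :
  exist _ (a :: w) raw = fp_inj (tagged a) * exist _ w (reduced_tl raw) :> FP.
Proof.
apply: val_inj; case: a raw => i g raw /=.
have := raw; rewrite reduced_consE => /and3P[g1 _ _].
by rewrite (word_cons_neq (w := [::])) //= word_consE.
Qed.

Lemma fp_gens_generate : generates gens.
Proof.
move=> [w rw]; elim: w rw => [|a w IH] rw.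
  by exists [::] => //; rewrite big_nil; apply: val_inj.
have [s sT sE] := IH (reduced_tl rw).
have [t tS tE] := S_generates (tagged a).
exists ([seq fp_inj g | g <- t] ++ s).
  move=> y; rewrite mem_cat => /orP[/mapP[g /tS Sg ->]|/sT//].
  by exists (tag a) => //; exists g.
by rewrite big_cat big_map -fp_inj_prod -tE /= -sE val_fp_inj_mul.
Qed.

(** The retraction sends each generator to itself or to 1, so it does not increase length. *)
Lemma len_fp_proj i x : (len (fp_inj (fp_proj i x)) <= len x)%N.
Proof.
have [s [<- sT ->]] := word_lengthP fp_gens_generate x.
elim: s sT => [|z s IH] sT.
  rewrite big_nil (_ : fp_inj _ = 1) ?word_length1//.
  by rewrite -(fp_inj1 G i) fp_injK.
rewrite big_cons fp_projM fp_injM.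
apply: leq_trans (word_lengthM fp_gens_generate _ _) _.
rewrite -[size _]/(1 + size s)%N leq_add ?IH// => [|t ts]; last first.
  by apply: sT; rewrite inE ts orbT.
have [j _ [g Sg <-]] : gens z by apply: sT; rewrite inE eqxx.
rewrite fp_proj_inj; have [ij|ij] := eqVneq i j.
  case: j / ij g Sg => g Sg; rewrite letter_proj_eq.
  by apply: word_length_gen; exists i => //; exists g.
by rewrite letter_proj_neq// fp_inj1 word_length1.
Qed.

(* A geodesic of the free product projects onto the free factor without
   becoming longer. *)
Lemma len_fp_inj_split i (g : G i) m n : len (fp_inj g) = (m + n)%N ->
  exists h k : G i,
    [/\ g = h * k, len (fp_inj h) = m & len (fp_inj k) = n].
Proof.
move=> gmn; have [s [ss sT gs]] := word_lengthP fp_gens_generate (fp_inj g).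
pose h := \prod_(z <- take m s) z; pose k := \prod_(z <- drop m s) z.
have gE : g = fp_proj i h * fp_proj i k.
  by rewrite -fp_projM -big_cat cat_take_drop -gs fp_injK.
have hm : (len (fp_inj (fp_proj i h)) <= m)%N.
  apply: leq_trans (len_fp_proj _ _) _; apply: leq_trans (word_length_le _) _.
    by move=> z /mem_take/sT.
  by rewrite size_take ss gmn; case: ltnP => // mn.
have kn : (len (fp_inj (fp_proj i k)) <= n)%N.
  apply: leq_trans (len_fp_proj _ _) _; apply: leq_trans (word_length_le _) _.
    by move=> z /mem_drop/sT.
  by rewrite size_drop ss gmn addKn.
have := word_lengthM fp_gens_generate (fp_inj (fp_proj i h)) (fp_inj (fp_proj i k)).
rewrite -fp_injM -gE gmn => le.
exists (fp_proj i h), (fp_proj i k); split=> //; apply/eqP; rewrite eqn_leq ?hm ?kn /=.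
  by rewrite -(leq_add2r n); apply: leq_trans le _; rewrite leq_add2l.
by rewrite -(leq_add2l m); apply: leq_trans le _; rewrite leq_add2r.
Qed.

Lemma finite_sphere i m : finite_set [set g : G i | len (fp_inj g) = m].
Proof.
apply: (@sub_finite_set _ _ (@fp_inj _ G i @^-1` ball_pred (cayley gens) 1 m.+1)).
  by move=> g /= gm; rewrite /ball_pred /= ltnS -gm.
apply: finite_preimage; first by move=> g h _ _; apply: (can_inj (@fp_injK _ G i)).
exact: finite_cayley_ball fp_gens_generate fp_gens_finite _.
Qed.

Definition sphere i m : seq (G i) :=
  enum_fset (fset_set [set g : G i | len (fp_inj g) = m]).

Lemma mem_sphere i m g : (g \in sphere i m) = (len (fp_inj g) == m).
Proof.
rewrite /sphere -[LHS]/(g \in fset_set _) in_fset_set; last exact: finite_sphere.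
by apply/asboolP/eqP.
Qed.

Lemma sphere_uniq i m : uniq (sphere i m).
Proof. exact: fset_uniq. Qed.

(** Each element of length [m + n] splits into elements of the factor of lengths [m] and [n]. Thus
    one radius controls all its multiples. *)
Lemma size_sphereD i m n :
  (size (sphere i (m + n)) <= size (sphere i m) * size (sphere i n))%N.
Proof.
rewrite -(size_allpairs (fun g h : G i => g * h)).
apply: uniq_leq_size; first exact: sphere_uniq.
move=> g; rewrite mem_sphere => /eqP/len_fp_inj_split[h [k [-> hm kn]]].
by apply: allpairs_f; rewrite mem_sphere ?hm ?kn.
Qed.

(** * Cones of words with a common prefix *)

Section Cone.
Variable u : FP.

(** Right multiplication by a generator affects at most the last letter or appends one, so a proper
    extension of [u] keeps the prefix [u]. *)
Lemma prefix_edge x y : cayley gens x y -> x <> u ->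
  prefix (val u) (val x) -> prefix (val u) (val y).
Proof.
move=> [z [i _ [g Sg <-]] ->] xu /prefixP[t xt].
have rx := valP x; rewrite xt in rx.
have -> : val (x * fp_inj g) = word_mul (val x) (word_cons (Tagged G g) [::]).
  by [].
rewrite xt word_mul_letter ?prefix_prefix// => t0; apply: xu; apply: val_inj.
by rewrite xt t0 cats0.
Qed.

(** An edge between the cone of words with prefix [u] and its complement has [u] as its endpoint in
    the cone; hence [u] is a cut vertex. *)
Lemma prefix_conn U x y : ~ U u -> conn (cayley gens) U x y ->
  prefix (val u) (val x) = prefix (val u) (val y).
Proof.
move=> Uu cxy; have neu z : U z -> z <> u by move=> Uz zu; apply: Uu; rewrite -zu.
apply/idP/idP; last apply: contraTT.
  apply: (conn_ind cxy (Q := fun z => prefix (val u) (val z))) => a b Ua Ub Eab.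
  exact: prefix_edge (neu a Ua).
apply: (conn_ind cxy (Q := fun z => ~~ prefix (val u) (val z))) => a b Ua Ub Eab.
apply: contraNN; apply: prefix_edge (neu b Ub).
exact: cayley_sym fp_gens_sym _ _ Eab.
Qed.

End Cone.

End FreeProductGraph.

(** * Rays along infinite words *)

(** If two initial segments of a shortest word had the same product, deleting the piece between them
    would give a shorter word. *)
Lemma word_length_take_inj (H : groupType) (T : set H) (s : seq H) i j :
  size s = word_length T (\prod_(z <- s) z)%g ->
  (forall z, z \in s -> T z) -> (i < j <= size s)%N ->
  (\prod_(z <- take i s) z)%g != (\prod_(z <- take j s) z)%g.
Proof.
move=> ss sT /andP[ij js]; apply/eqP => e.
have : (\prod_(z <- s) z = \prod_(z <- take i s ++ drop j s) z)%g.
  by rewrite -{1}(cat_take_drop j s) !big_cat /= e.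
move=> se; have := @word_length_le _ T (take i s ++ drop j s).
rewrite -se -ss size_cat size_drop size_takel ?(leq_trans (ltnW ij))// => h.
have : (size s <= i + (size s - j))%N.
  by apply: h => z; rewrite mem_cat => /orP[/mem_take|/mem_drop]; apply: sT.
rewrite leqNgt => /negP; apply.
by rewrite -[X in (_ < X)%N](subnKC js) ltn_add2r.
Qed.

Section InfiniteWords.
Local Open Scope group_scope.
Variables (r : nat) (G : 'I_r -> groupType) (S : forall i, set (G i)).
Hypothesis S_finite : forall i, finite_set (@S i).
Hypothesis S_sym : forall i (x : G i), S x -> S x^-1.
Hypothesis S_generates : forall i, generates (@S i).
Notation gens := (fp_gens S).
Notation FP := (free_product G).
Notation len := (word_length gens).
Implicit Types X Y : nat -> letter G.

Lemma reduced_mkseq X n : infinite_word X -> reduced (mkseq X n).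
Proof.
move=> [X1 XX]; apply/andP; split; first by apply/allP => a /mapP[k _ ->].
apply/(sortedP (X 0%N)) => i; rewrite size_mkseq => ni.
by rewrite !nth_mkseq ?(ltnW ni).
Qed.

Definition word_prefix X (iwX : infinite_word X) n : FP :=
  exist _ (mkseq X n) (reduced_mkseq n iwX).

Lemma word_prefixS X (iwX : infinite_word X) n :
  word_prefix iwX n.+1 = word_prefix iwX n * fp_inj (tagged (X n)).
Proof.
apply: val_inj; rewrite /= word_cons_neq ?(proj1 iwX)//= mkseqS -cats1.
have -> : Tagged G (tagged (X n)) = X n by case: (X n).
by rewrite word_mul_cat// cats1 -mkseqS; apply: reduced_mkseq.
Qed.

Lemma word_prefix_inj X (iwX : infinite_word X) : injective (word_prefix iwX).
Proof. by move=> m n /(congr1 (size \o val)); rewrite /= !size_mkseq. Qed.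

Lemma len_word_prefix X (iwX : infinite_word X) n :
  (len (word_prefix iwX n) <= \sum_(k < n) len (fp_inj (tagged (X k))))%N.
Proof.
have gen := fp_gens_generate S_generates.
elim: n => [|n IH].
  by rewrite big_ord0 (_ : word_prefix _ _ = 1) ?word_length1//; apply: val_inj.
rewrite big_ord_recr word_prefixS /=.
by apply: leq_trans (word_lengthM gen _ _) _; rewrite leq_add2r.
Qed.

Definition geodesic (a : letter G) : seq (G (tag a)) :=
  sval (cid (word_lengthP (S_generates (i := tag a)) (tagged a))).

Lemma geodesicP (a : letter G) : [/\ forall z, z \in geodesic a -> S z,
  \prod_(z <- geodesic a) z = tagged a &
  size (geodesic a) = word_length (@S (tag a)) (\prod_(z <- geodesic a) z)].
Proof. by rewrite /geodesic; case: cid => s /= [ss sT sE]; split; rewrite -?sE. Qed.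

Lemma geodesic_prod_inj (a : letter G) i j : (i < j <= size (geodesic a))%N ->
  \prod_(z <- take i (geodesic a)) z != \prod_(z <- take j (geodesic a)) z.
Proof.
by have [sS _ ss] := geodesicP a; apply: word_length_take_inj ss sS.
Qed.

Lemma geodesic_gt0 (a : letter G) : tagged a != 1 -> (0 < size (geodesic a))%N.
Proof.
rewrite lt0n; apply: contraNneq => /size0nil e.
by have [_ + _] := geodesicP a; rewrite e big_nil => <-.
Qed.

Section Ray.
Variable X : nat -> letter G.
Hypothesis iwX : infinite_word X.

(* The vertex reached after the prefix of length [st.1] and [st.2] generators
   of a geodesic for the next letter. *)
Definition word_vertex (st : nat * nat) : FP := word_prefix iwX st.1 *
  fp_inj (\prod_(z <- take st.2 (geodesic (X st.1))) z).

(** The last generator of a letter leads directly to the next prefix, encoded as [(n.+1, 0)], so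
    that no vertex is visited under two states. *)
Definition word_next (st : nat * nat) : nat * nat :=
  if (st.2.+1 < size (geodesic (X st.1)))%N then (st.1, st.2.+1)
  else (st.1.+1, 0%N).

Definition word_state k := iter k word_next (0%N, 0%N).

Definition word_ray k := word_vertex (word_state k).

Let state_lt (s t : nat * nat) :=
  (s.1 < t.1)%N || (s.1 == t.1) && (s.2 < t.2)%N.

Let geo_gt0 n : (0 < size (geodesic (X n)))%N.
Proof. by apply: geodesic_gt0; apply: (proj1 iwX). Qed.

Lemma word_state_lt k :
  ((word_state k).2 < size (geodesic (X (word_state k).1)))%N.
Proof.
elim: k => [|k IH]; first exact: geo_gt0.
rewrite /word_state iterS -/(word_state k) /word_next.
by case: ifP => //= _; apply: geo_gt0.
Qed.

Lemma word_state_homo : {homo word_state : i j / (i < j)%N >-> state_lt i j}.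
Proof.
apply: homo_ltn => [[y1 y2] [x1 x2] [z1 z2]|k].
  by rewrite /state_lt /=; lia.
rewrite /word_state iterS -/(word_state k) /word_next /state_lt.
by case: ifP => _ /=; rewrite ?ltnSn ?eqxx ?orbT.
Qed.

Lemma val_word_vertex n t : (t < size (geodesic (X n)))%N ->
  val (word_vertex (n, t)) = if t == 0%N then mkseq X n else
    rcons (mkseq X n) (Tagged G (\prod_(z <- take t (geodesic (X n))) z)).
Proof.
move=> tn; rewrite /word_vertex /=; case: eqP => [->|/eqP t0].
  by rewrite take0 big_nil word_cons1 word_mulw0// reduced_mkseq.
have g1 : \prod_(z <- take t (geodesic (X n))) z != 1.
  have := @geodesic_prod_inj (X n) 0 t; rewrite take0 big_nil eq_sym.
  by apply; rewrite lt0n t0 ltnW.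
rewrite word_cons_neq// word_mul_cat ?cats1//.
have := reduced_mkseq n.+1 iwX; rewrite mkseqS /reduced !all_rcons /= g1.
move=> /andP[/andP[_ ->]] /=.
by case: (mkseq X n) => //= a s; rewrite !rcons_path.
Qed.

Lemma word_vertex_inj m s n t : (s < size (geodesic (X m)))%N ->
  (t < size (geodesic (X n)))%N ->
  word_vertex (m, s) = word_vertex (n, t) -> (m, s) = (n, t).
Proof.
move=> sm tn /(congr1 val); rewrite !val_word_vertex//.
(* A proper initial part of a geodesic has not reached [X k], so a vertex strictly between two
   prefixes differs from the next prefix. *)
have full i k : (0 < i < size (geodesic (X k)))%N ->
    Tagged G (\prod_(z <- take i (geodesic (X k))) z) != X k.
  move=> /andP[i0 ik]; apply/eqP; case: (geodesicP (X k)) => _ gk _.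
  have := @geodesic_prod_inj (X k) i (size (geodesic (X k))).
  rewrite take_size gk ik leqnn => /(_ isT) /eqP ne.
  move: ne; set g := \prod_(z <- _) z; clearbody g; case: (X k) g {gk ik} => j h /= g ne.
  by move=> /eqP; rewrite eq_Tagged => /eqP /ne.
have [s0|s0] := posnP s; have [t0|t0] := posnP t.
- by move=> /(congr1 size); rewrite !size_mkseq s0 t0 => ->.
- rewrite s0 => e; have := congr1 size e; rewrite size_rcons !size_mkseq => mn.
  move: e; rewrite mn mkseqS => /rcons_inj/(congr1 snd)/= /esym/eqP.
  by rewrite (negPf (full t n _)) ?t0.
- rewrite t0 => e; have := congr1 size e; rewrite size_rcons !size_mkseq => mn.
  move: e; rewrite -mn mkseqS => /rcons_inj/(congr1 snd)/= /eqP.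
  by rewrite (negPf (full s m _)) ?s0.
- move=> e; have := congr1 size e; rewrite !size_rcons !size_mkseq => -[mn].
  move: e tn; rewrite -mn => /rcons_inj/(congr1 snd)/= /eqP.
  rewrite eq_Tagged /= => /eqP e tn; congr pair; apply/eqP.
  apply: contraT => st; have := st; rewrite neq_ltn => /orP[lt|lt].
    by have := @geodesic_prod_inj (X m) s t; rewrite lt (ltnW tn) e eqxx => /(_ isT).
  by have := @geodesic_prod_inj (X m) t s; rewrite lt (ltnW sm) e eqxx => /(_ isT).
Qed.

Lemma word_ray_ray : ray (cayley gens) word_ray.
Proof.
split=> [i j|k].
  rewrite /word_ray; have := word_state_lt i; have := word_state_lt j.
  have := @word_state_homo i j; have := @word_state_homo j i.
  case: (word_state i) (word_state j) => [m s] [n t] /= ji ij tn sm.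
  move=> /(word_vertex_inj sm tn)[mn st]; rewrite mn st /state_lt /= ltnn in ij ji.
  by move: ij ji; case: ltngtP => //; rewrite eqxx ltnn /= => h1 h2; lia.
rewrite /word_ray /word_state iterS -/(word_state k).
have := word_state_lt k; case: (word_state k) => n t /= tn.
have [sS gX _] := geodesicP (X n).
exists (fp_inj (nth 1 (geodesic (X n)) t)).
  exists (tag (X n)) => //; exists (nth 1 (geodesic (X n)) t) => //.
  by apply: sS; apply: mem_nth.
rewrite /word_vertex /word_next /= -mulgA -fp_injM -big_rcons -take_nth//.
case: ltnP => //= tn'; rewrite take0 big_nil fp_inj1 mulg1 word_prefixS.
by rewrite take_oversize// gX.
Qed.

Lemma word_ray_prefix n : exists k, word_ray k = word_prefix iwX n.
Proof.
suff [k ks] : exists k, word_state k = (n, 0%N).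
  by exists k; rewrite /word_ray ks /word_vertex /= take0 big_nil fp_inj1 mulg1.
elim: n => [|n [k IH]]; first by exists 0%N.
have walk t : (t < size (geodesic (X n)))%N -> word_state (t + k) = (n, t).
  elim: t => [|t IHt] tn; first exact: IH.
  rewrite addSn /word_state iterS -/(word_state (t + k)) IHt ?(ltnW tn)//.
  by rewrite /word_next /= tn.
exists (size (geodesic (X n)) + k)%N.
have := geo_gt0 n; case E0 : (size _) => [//|t] _.
rewrite addSn /word_state iterS -/(word_state (t + k)) walk ?E0//.
by rewrite /word_next /= E0 ltnn.
Qed.

Lemma infinite_word_end :
  exists w p, [/\ Omega_infty S w, rays w p &
    forall n, exists k, p k = word_prefix iwX n].
Proof.
have sym := fp_gens_sym S_sym.
exists (class_of_ray word_ray_ray), word_ray.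
have wr : rays (class_of_ray word_ray_ray) word_ray.
  by apply: class_of_rayP; apply: cayley_sym sym.
split=> //; last exact: word_ray_prefix.
exists X => //; exists word_ray => // n.
by have [k pk] := word_ray_prefix n; exists k; rewrite pk.
Qed.

End Ray.

(* Cutting the graph at a prefix [u] separates the words that start with [u]
   from the others. *)
Lemma tail_conn_prefix X Y (iwX : infinite_word X) (iwY : infinite_word Y)
    p q n m : ray (cayley gens) p -> ray (cayley gens) q ->
  (forall k, exists j, p j = word_prefix iwX k) ->
  (forall k, exists j, q j = word_prefix iwY k) ->
  tail_conn (cayley gens) (~` ball_pred (cayley gens) 1 m) p q ->
  X n <> Y n -> (m <= len (word_prefix iwX n.+1))%N.
Proof.
have Esym := cayley_sym (fp_gens_sym S_sym).
move=> rp rq pX qY pq XY; rewrite leqNgt; apply/negP => lt.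
set B := ball_pred _ _ _ in pq.
have finB : finite_set B.
  exact: finite_cayley_ball (fp_gens_generate S_generates) (fp_gens_finite S_finite) _.
(* From some index on the ray avoids [B]; only finitely many prefixes occur earlier, so a prefix
   longer than [n] occurs on this tail. *)
have far Z (iwZ : infinite_word Z) t : ray (cayley gens) t ->
    (forall k, exists j, t j = word_prefix iwZ k) ->
    exists N k j, [/\ (n < k)%N, t j = word_prefix iwZ k &
      forall i, (N <= i)%N -> conn (cayley gens) (~` B) (t i) (word_prefix iwZ k)].
  move=> [tinj Et] /choice[j jP].
  have [N tN] := injective_leaves_finite tinj finB.
  have jinj : injective j.
    by move=> a b ab; apply: (@word_prefix_inj _ iwZ); rewrite -!jP ab.
  have [M jM] := injective_leaves_finite jinj (finite_II N).
  exists N, (maxn M n.+1), (j (maxn M n.+1)); split=> //; first exact: leq_maxr.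
  move=> i Ni; rewrite -jP; apply: (conn_trans (y := t N)).
    by apply: conn_sym => //; apply: conn_tail.
  apply: conn_tail => //; rewrite leqNgt; apply/negP => h.
  by apply: (jM (maxn M n.+1)) => //; apply: leq_maxl.
have [N1 [k1 [j1 [nk1 _ c1]]]] := far _ _ _ rp pX.
have [N2 [k2 [j2 [nk2 _ c2]]]] := far _ _ _ rq qY.
have [i [j [+ + cij]]] := pq (maxn N1 N2).
rewrite !geq_max => /andP[Ni _] /andP[_ Nj].
have c := conn_trans (conn_trans (conn_sym Esym (c1 _ Ni)) cij) (c2 _ Nj).
have := prefix_conn S_sym (u := word_prefix iwX n.+1) _ c.
have take_mk Z k : (n < k)%N -> take n.+1 (mkseq Z k) = mkseq Z n.+1.
  by move=> nk; rewrite /mkseq -map_take take_iota (minn_idPl nk).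
rewrite /= !prefixE size_mkseq !take_mk// eqxx => h.
have := h (fun nb => nb lt); move/esym/eqP => /(congr1 (nth (X 0%N) ^~ n)).
by rewrite /= !nth_mkseq// => /esym.
Qed.

End InfiniteWords.

(** * Hausdorff measure and weighted words *)

Section HausdorffDimension.
Variables (R : realType) (T : Type) (d : T -> T -> R).
Implicit Types (A : set T) (delta eps eta : R).

Lemma hausdorff_pre_ge delta A eps (c : \bar R) :
  (forall (K : countType) (x : K -> T) (e : K -> R), ball_cover d A eps x e ->
     (c <= \esum_(k in [set: K]) (e k `^ delta)%:E)%E) ->
  (c <= hausdorff_pre d delta A eps)%E.
Proof. by move=> h; apply: le_ereal_inf_tmp => s [K [x [e [cov ->]]]]; exact: h cov. Qed.

Lemma hausdorff_pre_ge0 delta A eps : (0 <= hausdorff_pre d delta A eps)%E.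
Proof.
apply: hausdorff_pre_ge => K x e _; apply: esum_ge0 => k _.
by rewrite lee_fin powR_ge0.
Qed.

Lemma hausdorff_pre_nonincreasing delta A :
  {homo hausdorff_pre d delta A : e f / e <= f >-> (f <= e)%E}.
Proof.
move=> e f ef; apply: le_ereal_inf => s [K [x [g [[cA ge cov] sE]]]].
exists K, x, g; split=> //; split=> // k.
by have /andP[-> /lt_le_trans ->] := ge k.
Qed.

(** The pre-measures grow as the bound on the radii shrinks, so a lower bound for covers with radii
    below 1 passes to the limit. *)
Lemma hausdorff_measure_gt0 delta A (c : R) : 0 < c ->
  (forall (K : countType) (x : K -> T) (e : K -> R), ball_cover d A 1 x e ->
     (c%:E <= \esum_(k in [set: K]) (e k `^ delta)%:E)%E) ->
  hausdorff_measure d delta A <> 0%E.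
Proof.
move=> c0 h m0; suff : (c%:E <= hausdorff_measure d delta A)%E.
  by rewrite m0 lee_fin leNgt c0.
rewrite /hausdorff_measure; apply: lime_ge.
  apply: nonincreasing_at_right_is_cvge; near=> e => x y _ _.
  exact: hausdorff_pre_nonincreasing.
near=> e; apply: le_trans (hausdorff_pre_ge h) _.
apply: hausdorff_pre_nonincreasing.
by near: e; apply: nbhs_right_le.
Unshelve. all: by end_near. Qed.

Lemma esum_sigT_const (N : nat -> nat) (a : nat -> R) :
  (forall n, 0 <= a n) ->
  \esum_(k in [set: {n : nat & 'I_(N n)}]) (a (tag k))%:E =
  \esum_(n in [set: nat]) ((N n)%:R * a n)%:E.
Proof.
move=> a0; pose J n : set {n : nat & 'I_(N n)} :=
  [set` [seq Tagged (fun n => 'I_(N n)) i | i <- enum 'I_(N n)]].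
have JP n k : J n k <-> tag k = n.
  split=> [/mapP[i _ ->]//|]; case: k => m i /= <-.
  by apply/mapP; exists i; rewrite ?mem_enum.
have -> : [set: {n : nat & 'I_(N n)}] = \bigcup_(n in [set: nat]) J n.
  by apply/seteqP; split=> // k _; exists (tag k) => //; apply/JP.
rewrite esum_bigcupT; [|by move=> m n _ _ [k [/JP <- /JP <-]]|]; last first.
  by move=> k; rewrite lee_fin.
apply: eq_esum => n _; rewrite esum_fset; first last.
- by move=> k _; rewrite lee_fin.
- exact: finite_seq.
rewrite -fsbig_seq; last first.
  by rewrite map_inj_uniq ?enum_uniq// => i j /eqP; rewrite eq_Tagged => /eqP.
by rewrite big_map big_enum /= sumEFin sumr_const card_ord mulr_natl.
Qed.

(** This is countable subadditivity: [B n] is covered at cost [eta / 2 ^ n.+1] by balls of one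
    radius, and together these covers cost at most [eta]. Centers are sought in [A], as a cover of
    [A] requires. *)
Lemma hausdorff_measure0 delta A (B : nat -> set T) :
  A `<=` \bigcup_n B n ->
  (forall n eps eta, 0 < eps -> 0 < eta -> exists N (x : 'I_N -> T) rho,
     [/\ forall k, A (x k), 0 < rho < eps, N%:R * rho `^ delta <= eta &
      B n `<=` [set y | exists k, d (x k) y <= rho]]) ->
  hausdorff_measure d delta A = 0%E.
Proof.
move=> AB h; suff pre0 eps : 0 < eps -> hausdorff_pre d delta A eps = 0%E.
  apply: cvg_lim => //; apply: cvg_near_cst; near=> e; apply: pre0.
  by near: e; apply: nbhs_right_gt.
move=> eps0; apply/eqP; rewrite eq_le hausdorff_pre_ge0 andbT.
apply/lee_addgt0Pr => eta eta0; rewrite add0e.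
have /choice[f fP] : forall n, exists f : {N & ('I_N -> T) * R}%type,
    [/\ forall k, A ((tagged f).1 k), 0 < (tagged f).2 < eps,
      (tag f)%:R * (tagged f).2 `^ delta <= eta / (2 ^ n.+1)%:R &
      B n `<=` [set y | exists k, d ((tagged f).1 k) y <= (tagged f).2]].
  move=> n; have [|N [x [rho [xA re s cov]]]] := h n eps (eta / (2 ^ n.+1)%:R) eps0.
    by rewrite divr_gt0// ltr0n expn_gt0.
  by exists (Tagged (fun N => ('I_N -> T) * R)%type (x, rho)).
apply: (@le_trans _ _ (\esum_(n in [set: nat]) ((tag (f n))%:R * (tagged (f n)).2 `^ delta)%:E)%E).
  rewrite -(esum_sigT_const (fun n => tag (f n))
    (a := fun n => (tagged (f n)).2 `^ delta)); last first.
    by move=> n; apply: powR_ge0.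
  apply: ereal_inf_lbound.
  exists {n : nat & 'I_(tag (f n))}, (fun k => (tagged (f (tag k))).1 (tagged k)),
    (fun k => (tagged (f (tag k))).2); split=> //; split.
  - by move=> k; have [xA _ _ _] := fP (tag k); apply: xA.
  - by move=> k; have [_ re _ _] := fP (tag k).
  - move=> y /AB[n _]; have [_ _ _ cov] := fP n => /cov[k dk].
    by exists (Tagged (fun n => 'I_(tag (f n))) k).
rewrite -nneseries_esumT; last first.
  by move=> n; rewrite lee_fin mulr_ge0// powR_ge0.
apply: le_trans (epsilon_trick0 xpredT (ltW eta0)).
apply: lee_nneseries => n _; first by rewrite lee_fin mulr_ge0// powR_ge0.
by have [_ _ s _] := fP n; rewrite lee_fin.
Unshelve. all: by end_near. Qed.

Lemma hausdorff_dim_le delta A : 0 <= delta ->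
  hausdorff_measure d delta A = 0%E -> (hausdorff_dim d A <= delta%:E)%E.
Proof. by move=> d0 m0; apply: ereal_inf_lbound; exists delta. Qed.

Lemma hausdorff_dim_ge delta A :
  (forall delta', 0 <= delta' < delta -> hausdorff_measure d delta' A <> 0%E) ->
  (delta%:E <= hausdorff_dim d A)%E.
Proof.
move=> h; apply: le_ereal_inf_tmp => _ [e [e0 m0] <-].
by rewrite lee_fin leNgt; apply/negP => ed; apply: (h e) => //; rewrite e0.
Qed.

End HausdorffDimension.

(* If the words [c k] have total weight less than 1, one can avoid them by
   choosing the letters of a sequence one by one, keeping the weight of the
   words [c k] that extend the current word [u] below the weight of [u]. *)
Lemma avoid_light_words (R : realType) (T : choiceType) (A : seq T)
    (rho : T -> R) (K : choiceType) (J : set K) (c : K -> seq T) :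
  uniq A -> (forall a, 0 <= rho a) -> 1 <= \sum_(a <- A) rho a ->
  (\esum_(k in J) (\prod_(a <- c k) rho a)%:E < 1)%E ->
  exists f : nat -> T, (forall n, f n \in A) /\
    forall k, J k -> c k <> mkseq f (size (c k)).
Proof.
move=> uA rho0 rhoA lt1; pose w u : R := \prod_(a <- u) rho a.
pose W u : \bar R := \esum_(k in J) (if prefix u (c k) then (w (c k))%:E else 0%E).
have w0 u : 0 <= w u by apply: prodr_ge0.
have term0 u k : (0 <= if prefix u (c k) then (w (c k))%:E else 0)%E.
  by case: ifP; rewrite ?lee_fin.
(* Words properly extending [u] are sorted by their next letter. If no letter kept the inequality,
   summing over [A] would give [W u >= w u], as the weights of the letters add up to at least 1. *)
have step u : (W u < (w u)%:E)%E ->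
    exists a, a \in A /\ (W (rcons u a) < (w (rcons u a))%:E)%E.
  move=> Wu; apply: contrapT => h; move: Wu; apply/negP; rewrite -leNgt.
  have {}h a : a \in A -> ((w u * rho a)%:E <= W (rcons u a))%E.
    move=> aA; rewrite leNgt; apply/negP => lt; apply: h; exists a; split=> //.
    by apply: lt_le_trans lt _; rewrite /w -cats1 big_cat big_seq1.
  apply: (@le_trans _ _ (\sum_(a <- A) (w u * rho a)%:E)%E).
    by rewrite sumEFin lee_fin -mulr_sumr ler_peMr.
  apply: (@le_trans _ _ (\sum_(a <- A) W (rcons u a))%E).
    by rewrite big_seq [leRHS]big_seq; apply: lee_sum => a; apply: h.
  rewrite /W -esum_sum//; apply: le_esum => k _.
  case: ifPn => [/prefixP[t ->]|pu]; last first.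
    rewrite big1// => a _; case: ifP => // /prefixP[t ct].
    by rewrite ct cat_rcons prefix_prefix in pu.
  have pE a : prefix (rcons u a) (u ++ t) = (if t is b :: _ then a == b else false).
    elim: (u) => [|c' u' /= ->]; last by rewrite eqxx.
    by case: (t) => [|b t'] //=; rewrite prefix0s andbT.
  under eq_bigr do rewrite pE.
  case: t {pE} => [|b t]; first by rewrite big1// lee_fin.
  rewrite -big_mkcond /=; have [bA|bA] := boolP (b \in A).
    by rewrite -big_filter filter_pred1_uniq// big_seq1.
  by rewrite big_seq_cond big_pred0 ?lee_fin// => a; apply/negP => /andP[aA /eqP ab];
    rewrite -ab aA in bA.
have [a0 a0A] : exists a0, a0 \in A.
  case: (A) rhoA => [|a s] A1; last by exists a; rewrite inE eqxx.
  by move: A1; rewrite big_nil ler10.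
have /choice[h hP] : forall u, exists a, a \in A /\
    ((W u < (w u)%:E)%E -> (W (rcons u a) < (w (rcons u a))%:E)%E).
  move=> u; have [Wu|Wu] := pselect (W u < (w u)%:E)%E.
    by have [a [aA lt]] := step u Wu; exists a.
  by exists a0.
pose U n := iter n (fun u => rcons u (h u)) [::].
have UE n : U n = mkseq (fun n => h (U n)) n.
  by elim: n => // n IH; rewrite mkseqS -IH.
have WU n : (W (U n) < (w (U n))%:E)%E.
  elim: n => [|n IH]; last by have [_] := hP (U n); apply.
  rewrite /= /w big_nil; apply: le_lt_trans lt1.
  by apply: le_esum => k _; rewrite prefix0s.
exists (fun n => h (U n)); split=> [n|k Jk ck]; first by have [] := hP (U n).
(* A word [c k] equal to a prefix [U n] would by itself contribute [w (U n)] to [W (U n)]. *)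
have := WU (size (c k)); rewrite UE -ck ltNge => /negP; apply.
apply: esum_ge; exists [set k].
  by split; [apply: finite_set1|move=> _ ->].
by rewrite fsbig_set1 prefix_refl.
Qed.

(** Meant for [b k] the cost of a ball, [a k] the weight of a word attached to it, and [c] the
    bounded loss between them. The sum of [b] is finite, which permits division by [c]. *)
Lemma esum_lt_rescale (R : realType) (K : choiceType) (J : set K)
    (a b : K -> R) (c : R) : 0 < c -> (forall k, 0 <= b k) ->
  (forall k, J k -> a k * c <= b k) ->
  (\esum_(k in [set: K]) (b k)%:E < c%:E)%E ->
  (\esum_(k in J) (a k)%:E < 1)%E.
Proof.
move=> c0 b0 ab bc.
have : (0 <= \esum_(k in [set: K]) (b k)%:E)%E.
  by apply: esum_ge0 => k _; rewrite lee_fin.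
case sE : (\esum_(k in _) _)%E bc => [s| |]; rewrite ?lte_fin// => sc _.
apply: (@le_lt_trans _ _ (s / c)%:E); last by rewrite lte_fin ltr_pdivrMr// mul1r.
apply: ge_ereal_sup => _ [X [finX XJ] <-].
apply: (@le_trans _ _ (\sum_(k \in X) c^-1%:E * (b k)%:E)%E).
  apply: lee_fsum => // k /XJ Jk; rewrite -EFinM lee_fin mulrC.
  by rewrite ler_pdivlMr// ab.
rewrite -ge0_mule_fsumr; last by move=> k; rewrite lee_fin.
rewrite mulrC EFinM lee_pmul2l ?lte_fin ?invr_gt0// -sE.
by apply: esum_ge; exists X.
Qed.

(** * The upper bound *)

Lemma expr_lt_eventually (R : realType) (t e : R) : 0 <= t < 1 -> 0 < e ->
  exists N, forall n, (N <= n)%N -> t ^+ n < e.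
Proof.
move=> /andP[t0 t1] e0; have t1' : `|t| < 1 by rewrite ger0_norm.
have /cvgrPdist_lt/(_ _ e0)[N _ HN] := cvg_expr t1'.
exists N => n /HN; rewrite /= sub0r normrN ger0_norm//.
exact: exprn_ge0.
Qed.

Lemma word_lengthV (H : groupType) (T : set H) (x : H) : generates T ->
  (forall y, T y -> T y^-1)%g -> (word_length T x^-1%g <= word_length T x)%N.
Proof.
move=> Tgen Tsym; have [s [<- sT ->]] := word_lengthP Tgen x.
elim: s sT => [|z s IH] sT; first by rewrite big_nil invg1 word_length1.
rewrite big_cons invgM; apply: leq_trans (word_lengthM Tgen _ _) _.
rewrite /= -addn1 leq_add ?IH//; first by move=> t ts; apply: sT; rewrite inE ts orbT.
by apply: word_length_gen; apply: Tsym; apply: sT; rewrite inE eqxx.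
Qed.

Lemma word_length_mulKg (H : groupType) (T : set H) (x y : H) : generates T ->
  (forall y, T y -> T y^-1)%g ->
  (word_length T y <= word_length T x + word_length T (x * y)%g)%N.
Proof.
move=> Tgen Tsym; rewrite -{1}(mulKg x y).
by apply: leq_trans (word_lengthM Tgen _ _) _; rewrite leq_add2r word_lengthV.
Qed.

Lemma conn_prod (H : groupType) (T U : set H) (y : H) (s : seq H) :
  (forall z, z \in s -> T z) ->
  (forall t, (t <= size s)%N -> U (y * \prod_(z <- take t s) z)%g) ->
  conn (cayley T) U y (y * \prod_(z <- s) z)%g.
Proof.
move=> sT sU; exists (size s), (fun t => y * \prod_(z <- take t s) z)%g.
split=> //; first by rewrite take0 big_nil mulg1.
  by rewrite take_size.
move=> k ks; exists (nth 1%g s k); first by apply: sT; apply: mem_nth.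
by rewrite (take_nth 1%g)// big_rcons mulgA.
Qed.

Section UpperBound.
Variables (R : realType) (r : nat) (G : 'I_r -> groupType).
Variables (S : forall i, set (G i)) (alpha : R).
Hypothesis S_finite : forall i, finite_set (@S i).
Hypothesis S_sym : forall i (x : G i), S x -> S (x^-1)%g.
Hypothesis S_generates : forall i, generates (@S i).
Hypothesis alpha01 : 0 < alpha < 1.
Notation gens := (fp_gens S).
Notation FP := (free_product G).
Notation len := (word_length gens).
Notation ball m := (ball_pred (cayley gens) 1%g m).
Variable i : 'I_r.

(** The pair [(x, h)] labels the component of [x h] outside the ball. Ends with a common label are
    at distance at most [alpha ^+ k], so counting labels bounds the number of balls. *)
Definition crossing (w : fp_end S) k (x : FP) (h : G i) :=
  exists q, rays w q /\ exists j0, forall j, (j0 <= j)%N ->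
    conn (cayley gens) (~` ball k) (x * fp_inj h)%g (q j).

Lemma crossing_end_dist w w' k x h : crossing w k x h -> crossing w' k x h ->
  fp_end_dist S alpha w w' <= alpha ^+ k.
Proof.
move=> [q [wq [j jq]]] [q' [wq' [j' jq']]].
have Esym := cayley_sym (fp_gens_sym S_sym).
have gen := fp_gens_generate S_generates.
apply: (end_dist_le Esym (finite_cayley_ball gen (fp_gens_finite S_finite)) alpha01 wq wq').
move=> N; exists (maxn j N), (maxn j' N); rewrite !leq_maxr; split=> //.
apply: conn_trans (conn_sym Esym (jq _ _)) (jq' _ _); exact: leq_maxl.
Qed.

(** A late vertex [p j0] is cut as [h g] with [h] of length [k + n]. The geodesic way from [h] to
    [p j0], and the ray beyond, keep length at least [k + n]; translation by [x] loses less than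
    [n], so [ball k] is avoided. *)
Lemma crossing_exists w k n x p : rays w (fun j => x * fp_inj (p j))%g ->
  ray (cayley (@S i)) p -> (len x < n)%N ->
  exists h, h \in sphere S i (k + n) /\ crossing w k x h.
Proof.
have Esym := cayley_sym (fp_gens_sym S_sym).
have gen := fp_gens_generate S_generates.
move=> wp [pinj Ep] xn.
have injp : injective (fun j => fp_inj (p j) : FP).
  by move=> a b /(can_inj (@fp_injK _ G i)) /pinj.
have [j0 pj0] := injective_leaves_finite injp
  (finite_cayley_ball gen (fp_gens_finite S_finite) (k + n)%N).
have far y : (k + n <= len y)%N -> (~` ball k) (x * y)%g.
  move=> yM; rewrite /ball_pred /= -[gdist _ _ _]/(len (x * y)%g) => lt.
  have : (len y <= len x + len (x * y)%g)%N.
    exact: word_length_mulKg gen (fp_gens_sym S_sym).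
  lia.
have far_p j : (j0 <= j)%N -> (k + n <= len (fp_inj (p j)))%N.
  by move=> /pj0 nb; rewrite leqNgt; apply/negP.
have [|h [g [pE hM gM]]] := @len_fp_inj_split _ _ S S_generates _ (p j0) (k + n)
    (len (fp_inj (p j0)) - (k + n)).
  by rewrite subnKC// far_p.
exists h; split; first by rewrite mem_sphere// hM.
exists (fun j => x * fp_inj (p j))%g; split=> //; exists j0 => j jj.
have [_ Eq] := rays_ray wp.
apply: conn_trans (conn_tail (p := fun j => (x * fp_inj (p j))%g) (N := j0) Eq _ jj); last first.
  by move=> l jl; apply/far/far_p.
have [s [ss sT gs]] := word_lengthP gen (fp_inj g).
rewrite pE fp_injM gs mulgA; apply: conn_prod => // t ts.
rewrite -mulgA; apply: far; set y := (_ * _)%g.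
pose d : FP := (\prod_(z <- drop t s) z)%g.
have pyd : fp_inj (p j0) = (y * d)%g :> FP.
  by rewrite pE fp_injM gs /y /d -mulgA -big_cat cat_take_drop.
have le1 : (len (fp_inj (p j0)) <= len y + len d)%N.
  by rewrite pyd; apply: word_lengthM.
have le2 : (len d <= size s - t)%N.
  rewrite -size_drop; apply: word_length_le => z /mem_drop; exact: sT.
have le3 := far_p j0 (leqnn _).
move: le1 le2 le3 ss gM ts; move: (len y) (len d) (len _) (len _); lia.
Qed.

Lemma size_sphereX m q :
  (size (sphere S i (m * q.+1)) <= size (sphere S i m) ^ q.+1)%N.
Proof.
elim: q => [|q IH]; first by rewrite muln1 expn1.
rewrite mulnS expnS; apply: leq_trans (size_sphereD _ _ _ _ _) _ => //.
by rewrite leq_mul2l IH orbT.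
Qed.

Lemma Omega_measure0 delta m : 0 <= delta -> (0 < m)%N ->
  (size (sphere S i m))%:R * (alpha `^ delta) ^+ m < 1 ->
  hausdorff_measure (fp_end_dist S alpha) delta (Omega S i) = 0%E.
Proof.
move=> delta0 m0 small; have /andP[a0 a1] := alpha01.
have gen := fp_gens_generate S_generates.
pose z := alpha `^ delta; have z0 : 0 < z by apply: powR_gt0.
pose B n := [set w : fp_end S | Omega S i w /\ exists x p,
  [/\ (len x < n)%N, ray (cayley (@S i)) p & rays w (fun j => x * fp_inj (p j))%g]].
apply: (@hausdorff_measure0 _ _ _ _ _ B).
  move=> w wO; case: (wO) => x [w0 [[w1 w10] wE]].
  have [p w1p] := rays_nonempty (cayley_sym (@S_sym i)) w1.
  exists (len x).+1 => //; split=> //; exists x, p; split=> //.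
    exact: rays_ray w1p.
  by rewrite wE; exists (fun j => fp_inj (p j)) => //; apply: w10.
move=> n eps eta eps0 eta0.
have finB : finite_set (ball n : set FP).
  exact: finite_cayley_ball gen (fp_gens_finite S_finite) _.
pose bs : seq FP := enum_fset (fset_set (ball n)).
pose t := (size (sphere S i m))%:R * z ^+ m.
have t01 : 0 <= t < 1 by rewrite small andbT mulr_ge0// exprn_ge0// ltW.
(* [c] collects the number of translates and the factor [z ^- n] lost between the exponents [k + n]
   and [k]; the successor keeps it positive. *)
pose c := (size bs).+1%:R * z ^- n.
have c0 : 0 < c by rewrite mulr_gt0// invr_gt0 exprn_gt0.
have [N1 tN] := expr_lt_eventually t01 (divr_gt0 eta0 c0).
have a01 : 0 <= alpha < 1 by rewrite ltW.
have [N2 aN] := expr_lt_eventually a01 eps0.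
(* [N1] controls the cost and [N2] the radius; [k + n] is a multiple of [m], so that
   submultiplicativity applies. *)
pose q := (n + N1 + N2)%N; pose k := (m * q.+1 - n)%N.
have kn : (k + n = m * q.+1)%N by rewrite /k /q; nia.
(* Only labels carried by an end of [B n] are kept, so that each ball gets a center in
   [Omega S i]. *)
pose L := [seq xh <- [seq (x, h) | x <- bs, h <- sphere S i (k + n)] |
  `[< exists w, B n w /\ crossing w k xh.1 xh.2 >]].
have /choice[f fP] : forall l : 'I_(size L), exists w, B n w /\
    forall xh, crossing w k (nth xh L l).1 (nth xh L l).2.
  move=> l; have [xh0 _] : exists xh, xh \in L.
    by case: (L) l => [[]//|xh s] _; exists xh; rewrite inE eqxx.
  have := mem_nth xh0 (ltn_ord l); rewrite mem_filter => /andP[/asboolP[w [Bw cw]] _].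
  by exists w; split=> // xh; rewrite (set_nth_default xh0).
exists (size L), f, (alpha ^+ k); split.
- by move=> l; have [[]] := fP l.
- by rewrite exprn_gt0//= aN// /k /q; nia.
- have -> : (alpha ^+ k) `^ delta = z ^+ k.
    by rewrite -powR_mulrn ?ltW// powRAC powR_mulrn// ltW.
  have sL : (size L <= size bs * size (sphere S i m) ^ q.+1)%N.
    rewrite size_filter; apply: leq_trans (count_size _ _) _.
    by rewrite size_allpairs leq_mul2l kn size_sphereX orbT.
  have zk : z ^+ k = z ^- n * (z ^+ m) ^+ q.+1.
    by rewrite -exprM -kn exprD mulrCA mulVf ?mulr1// expf_neq0// gt_eqF.
  have : t ^+ q.+1 < eta / c by apply: tN; rewrite /q; lia.
  rewrite ltr_pdivlMr// => /ltW; apply: le_trans.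
  rewrite zk /t /c exprMn [leRHS]mulrC -!mulrA mulrCA [leRHS]mulrCA.
  rewrite ler_pM2l ?invr_gt0 ?exprn_gt0// mulrA.
  rewrite ler_pM2r ?exprn_gt0// -natrX -natrM ler_nat.
  by apply: leq_trans sL _; rewrite leq_mul2r leqnSn orbT.
move=> w Bw; case: (Bw) => _ [x [p [xn rp wp]]].
have [h [hs cr]] := crossing_exists k wp rp xn.
have xhL : (x, h) \in L.
  rewrite mem_filter; apply/andP; split; first by apply/asboolP; exists w.
  apply: allpairs_f => //; rewrite -[_ \in _]/(x \in fset_set (ball n)).
  by rewrite in_fset_set//; apply/asboolP.
have lt : (index (x, h) L < size L)%N by rewrite index_mem.
exists (Ordinal lt); apply: (crossing_end_dist (x := x) (h := h)) => //.
have [_ /(_ (x, h))] := fP (Ordinal lt).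
by rewrite /= nth_index.
Qed.

End UpperBound.

(** * The lower bound *)

Section LowerBound.
Variables (R : realType) (r : nat) (G : 'I_r -> groupType).
Variables (S : forall i, set (G i)) (alpha : R).
Hypothesis S_finite : forall i, finite_set (@S i).
Hypothesis S_sym : forall i (x : G i), S x -> S (x^-1)%g.
Hypothesis S_generates : forall i, generates (@S i).
Hypothesis alpha01 : 0 < alpha < 1.
Notation gens := (fp_gens S).
Notation FP := (free_product G).
Notation len := (word_length gens).
Variables (F : seq (letter G)) (y : letter G).
Hypothesis F_uniq : uniq F.
Hypothesis y1 : tagged y != 1%g.
Hypothesis F1 : forall a : letter G, a \in F -> tagged a != 1%g.
Hypothesis Fy : forall a : letter G, a \in F -> tag a != tag y.

(** Since [y] lies in a factor that contains no letter of [F], the letters [f n] can be chosen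
    independently and the word stays reduced. *)
Definition code_word (f : nat -> letter G) n : letter G :=
  if odd n then y else f n./2.

Definition block_length (a : letter G) : nat :=
  (len (fp_inj (tagged a)) + len (fp_inj (tagged y)))%N.

Definition code_length (f : nat -> letter G) n : nat :=
  \sum_(j < n) block_length (f j).

Lemma code_word_infinite f : (forall n, f n \in F) ->
  infinite_word (code_word f).
Proof.
move=> fF; split=> n; rewrite /code_word; first by case: odd => //; apply: F1.
by rewrite /=; case: odd; rewrite /= ?Fy// eq_sym Fy.
Qed.

(** The length [n.*2.+1] is the first at which a prefix shows [f n]; the bound also counts the
    separator that follows. *)
Lemma len_code_word f (iw : infinite_word (code_word f)) n :
  (len (word_prefix iw n.*2.+1) <= code_length f n.+1)%N.
Proof.
apply: leq_trans (len_word_prefix S_generates iw _) _.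
rewrite /code_length; elim: n => [|n IH].
  by rewrite !big_ord_recr !big_ord0 /= !add0n leq_addr.
rewrite doubleS 2!big_ord_recr [leqRHS]big_ord_recr /= /block_length.
have lenE k a : code_word f k = a ->
    len (fp_inj (tagged (code_word f k))) = len (fp_inj (tagged a)) by move->.
rewrite (lenE _ y) ?(lenE n.*2.+2 (f n.+1)); first last.
- by rewrite /code_word /= odd_double.
- by rewrite /code_word /= odd_double /= doubleK.
by rewrite -addnA leq_add// addnC.
Qed.

Lemma block_length_gt0 a : a \in F -> (0 < block_length a)%N.
Proof.
move=> aF; rewrite addn_gt0 (word_length_gt0 (fp_gens_generate S_generates))//.
apply/eqP => /(congr1 (fp_proj (tag a))); rewrite fp_injK => e.
by have := F1 aF; rewrite e /fp_proj /word_proj /= big_nil eqxx.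
Qed.

Lemma code_length_ge f n : (forall n, f n \in F) -> (n <= code_length f n)%N.
Proof.
move=> fF; rewrite -{1}[n]muln1 -[(n * 1)%N](_ : \sum_(j < n) 1 = _)%N; last first.
  by rewrite sum_nat_const card_ord.
by apply: leq_sum => j _; apply: block_length_gt0.
Qed.

Definition coded f (w : fp_end S) := (forall n, f n \in F) /\
  Omega_infty S w /\ exists2 p, rays w p &
    forall n, exists k, val (p k) = mkseq (code_word f) n.

Lemma coded_exists f : (forall n, f n \in F) -> exists w, coded f w.
Proof.
move=> fF; have iw := code_word_infinite fF.
have [w [p [wO wp pw]]] := infinite_word_end S_sym S_generates iw.
exists w; split=> //; split=> //; exists p => // n.
by have [k pk] := pw n; exists k; rewrite pk.
Qed.

Variable delta : R.
Hypothesis delta0 : 0 <= delta.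
Let z := alpha `^ delta.
Let C := \max_(a <- F) block_length a.

(** With [alpha ^+ m.+1 <= e < alpha ^+ m], [n] is least such that [n.+1] blocks have total length
    above [m]. An earlier disagreement would occur at a prefix of length at most [m], whose removal
    separates the ends. The last block adds at most [C]. *)
Lemma ball_code_prefix (w0 w : fp_end S) f e : 0 < e < 1 -> coded f w ->
  fp_end_dist S alpha w0 w <= e ->
  exists n, z ^+ code_length f n * z ^+ C <= e `^ delta /\
    forall g w', coded g w' -> fp_end_dist S alpha w0 w' <= e ->
      mkseq f n = mkseq g n.
Proof.
move=> /andP[e0 e1] [fF [_ [p wp pf]]] we; have /andP[a0 a1] := alpha01.
have Esym := cayley_sym (fp_gens_sym S_sym).
have finB := finite_cayley_ball (fp_gens_generate S_generates) (fp_gens_finite S_finite).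
have [m [me em]] : exists m, alpha ^+ m.+1 <= e /\ e < alpha ^+ m.
  have exm : exists m, alpha ^+ m <= e.
    have a01 : 0 <= alpha < 1 by rewrite ltW.
    by have [N /(_ N (leqnn N)) /ltW] := expr_lt_eventually a01 e0; exists N.
  have [[|m] me min] := ex_minnP exm; first by rewrite expr0 leNgt e1 in me.
  by exists m; split=> //; rewrite ltNge; apply/negP => /min; rewrite ltnn.
have [p0 wp0] := rays_nonempty Esym w0.
have tc w' p' : rays w' p' -> fp_end_dist S alpha w0 w' <= e ->
    tail_conn (cayley gens) (~` ball_pred (cayley gens) 1%g m.+1) p0 p'.
  by move=> wp' /le_lt_trans/(_ em); apply: end_dist_lt.
have exn : exists n, (m < code_length f n.+1)%N.
  by exists m; apply: code_length_ge.
have [n nm nmin] := ex_minnP exn.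
have small j : (j < n)%N -> (code_length f j.+1 <= m)%N.
  by move=> jn; rewrite leqNgt; apply/negP => /nmin; rewrite leqNgt jn.
have z01 : 0 <= z <= 1.
  by rewrite powR_ge0 /z -[leRHS](powRr0 alpha) ger_powR// a0 ltW.
exists n; split.
  apply: (@le_trans _ _ (z ^+ m.+1)).
    rewrite -exprD; apply: ler_wiXn2l; [by case/andP: z01 ..|].
    apply: leq_trans nm _; rewrite /code_length big_ord_recr /= leq_add2l.
    exact: leq_bigmax_seq.
  rewrite /z -powR_mulrn ?powR_ge0// powRAC powR_mulrn ?(ltW a0)//.
  by rewrite ge0_ler_powR ?nnegrE ?exprn_ge0// ltW.
move=> g w' [gF [_ [p' wp' pg]]] w'e; apply/eq_in_map => j.
rewrite mem_iota add0n => /andP[_ jn]; apply: contrapT => fg.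
have iwf := code_word_infinite fF; have iwg := code_word_infinite gF.
have pref h (iwh : infinite_word (code_word h)) (t : nat -> FP) :
    (forall n, exists k, val (t k) = mkseq (code_word h) n) ->
    forall n, exists k, t k = word_prefix iwh n.
  by move=> th k; have [l tl] := th k; exists l; apply: val_inj.
(* The center [w0] may lie outside the Cantor set; its ray [p0] links the rays of [w] and [w']. *)
have := tail_conn_prefix S_finite S_sym S_generates (rays_ray wp) (rays_ray wp')
  (pref _ iwf _ pf) (pref _ iwg _ pg)
  (tail_conn_trans Esym (rays_ray wp0) (finB _)
    (tail_conn_sym Esym (tc _ _ wp we)) (tc _ _ wp' w'e)) (n := j.*2).
rewrite /code_word odd_double doubleK => /(_ fg).
move=> le; have := leq_trans le (len_code_word iwf j).
by rewrite ltnNge small.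
Qed.

Lemma prod_code_length f n :
  \prod_(a <- mkseq f n) z ^+ block_length a = z ^+ code_length f n.
Proof.
elim: n => [|n IH]; first by rewrite /code_length big_nil big_ord0 expr0.
rewrite mkseqS -cats1 big_cat big_seq1 IH /code_length big_ord_recr /=.
by rewrite [RHS]exprD.
Qed.

(** A cover of cost below [z ^+ C] yields words of total weight below 1, one for each ball meeting
    the Cantor set. A sequence avoiding them all defines an end of this set in none of the balls. *)
Lemma Omega_infty_measure_neq0 :
  1 <= \sum_(a <- F) z ^+ block_length a ->
  hausdorff_measure (fp_end_dist S alpha) delta (Omega_infty S) <> 0%E.
Proof.
move=> Fsum; have /andP[a0 _] := alpha01.
have z0 : 0 < z by apply: powR_gt0.
have zC0 : 0 < z ^+ C by apply: exprn_gt0.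
apply: (hausdorff_measure_gt0 zC0) => K x e [xO e01 cov].
rewrite leNgt; apply/negP => lt.
pose J := [set k : K | exists f w, coded f w /\ fp_end_dist S alpha (x k) w <= e k].
have /choice[c cP] : forall k, exists u : seq (letter G), J k ->
    (\prod_(a <- u) z ^+ block_length a) * z ^+ C <= e k `^ delta /\
    forall g w, coded g w -> fp_end_dist S alpha (x k) w <= e k ->
      u = mkseq g (size u).
  move=> k; have [[f [w [fw we]]]|nJ] := pselect (J k); last by exists [::].
  have [n [nC ng]] := ball_code_prefix (e01 k) fw we.
  exists (mkseq f n) => _; rewrite prod_code_length size_mkseq.
  by split.
have light : (\esum_(k in J) (\prod_(a <- c k) z ^+ block_length a)%:E < 1)%E.
  apply: esum_lt_rescale zC0 _ _ lt; first by move=> k; apply: powR_ge0.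
  by move=> k /cP[].
have z_ge0 a : 0 <= z ^+ block_length a by apply/exprn_ge0/ltW.
have [f [fF favoid]] := avoid_light_words F_uniq z_ge0 Fsum light.
have [w fw] := coded_exists fF.
have [k _ /= xk] := cov w (proj1 (proj2 fw)).
have Jk : J k by exists f, w.
by apply: (favoid k Jk); have [_ h] := cP k Jk; apply: h fw xk.
Qed.

End LowerBound.

(** * Comparison of the two bounds *)

Section Comparison.
Variables (R : realType) (r : nat) (G : 'I_r -> groupType).
Variables (S : forall i, set (G i)) (alpha : R).
Hypothesis S_finite : forall i, finite_set (@S i).
Hypothesis S_sym : forall i (x : G i), S x -> S (x^-1)%g.
Hypothesis S_generates : forall i, generates (@S i).
Hypothesis alpha01 : 0 < alpha < 1.
Notation gens := (fp_gens S).
Notation len := (word_length gens).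

Lemma continuous_powR_exponent n : continuous (fun delta : R => (alpha `^ delta) ^+ n).
Proof.
have /andP[a0 _] := alpha01; move=> delta.
have -> : (fun delta : R => (alpha `^ delta) ^+ n) =
    (fun x => x ^+ n) \o (expR \o ( *%R^~ (ln alpha))).
  by apply/funext => x; rewrite /powR gt_eqF.
apply: continuous_comp; last exact: exprn_continuous.
by apply: continuous_comp; [exact: mulrr_continuous|exact: continuous_expR].
Qed.

Lemma continuous_sum_powR (T : Type) (F : seq T) (c : T -> nat) :
  continuous (fun delta : R => \sum_(a <- F) (alpha `^ delta) ^+ c a).
Proof.
move=> delta; elim: F => [|a F IH].
  rewrite (_ : (fun _ => _) = cst 0); first exact: cvg_cst.
  by apply/funext => x; rewrite big_nil.
rewrite (_ : (fun _ => _) = (fun x => (alpha `^ x) ^+ c a) \+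
    (fun x => \sum_(b <- F) (alpha `^ x) ^+ c b)).
  by apply: cvgD; [exact: continuous_powR_exponent|exact: IH].
by apply/funext => x; rewrite big_cons.
Qed.

(** By continuity the inequality persists at some exponent above [delta], and the sum is at least as
    large at all smaller exponents. This margin makes the final comparison strict. *)
Lemma Omega_infty_dim_gt (F : seq (letter G)) (y : letter G) (delta : R) :
  uniq F -> tagged y != 1%g -> (forall a : letter G, a \in F -> tagged a != 1%g) ->
  (forall a : letter G, a \in F -> tag a != tag y) -> 0 <= delta ->
  1 < \sum_(a <- F) (alpha `^ delta) ^+ block_length S y a ->
  exists delta1, delta < delta1 /\
    (delta1%:E <= hausdorff_dim (fp_end_dist S alpha) (Omega_infty S))%E.
Proof.
move=> uF y1 F1 Fy delta0 gt1; have /andP[a0 a1] := alpha01.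
pose g x := \sum_(a <- F) (alpha `^ x) ^+ block_length S y a.
have cg : g x @[x --> delta] --> g delta by apply: continuous_sum_powR.
have [x [dx gx]] : exists x, delta < x /\ 1 < g x.
  have nx : \forall x \near delta^'+, delta < x /\ 1 < g x.
    near=> x; split; first by near: x; apply: nbhs_right_gt.
    near: x; apply: (cvgr_gt (F := delta^'+) (f := g) _ _ 1 gt1).
    exact: cvg_at_right_filter.
  exact: filter_ex nx.
exists x; split=> //; apply: hausdorff_dim_ge => e /andP[e0 ex].
apply: (Omega_infty_measure_neq0 S_finite S_sym S_generates alpha01 uF y1 F1 Fy e0).
apply: le_trans (ltW gx) _; apply: ler_sum => a _; apply: lerXn2r.
- by rewrite nnegrE powR_ge0.
- by rewrite nnegrE powR_ge0.
by rewrite ger_powR// ?a0 ltW.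
Unshelve. all: by end_near. Qed.

(** Each sphere of radius 1 to [N] contributes at least 1, and different radii give disjoint
    spheres. Radius 0 is left out because the identity is not a letter. *)
Lemma spheres_sum i (z : R) N : 0 <= z ->
  (forall m, (0 < m)%N -> 1 <= (size (sphere S i m))%:R * z ^+ m) ->
  exists F : seq (G i), [/\ uniq F,
    forall g, g \in F -> (0 < len (fp_inj g) <= N)%N &
    N%:R <= \sum_(g <- F) z ^+ len (fp_inj g)].
Proof.
move=> z0 s1; elim: N => [|N [F [uF FN FS]]].
  by exists [::]; split=> //; rewrite big_nil.
exists (F ++ sphere S i N.+1); split.
- rewrite cat_uniq uF (sphere_uniq S i) andbT; apply/hasPn => g.
  rewrite mem_sphere// => /eqP gN; apply/negP => /FN.
  by rewrite gN ltnn andbF.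
- move=> g; rewrite mem_cat => /orP[/FN/andP[-> /= /leqW //]|].
  by rewrite mem_sphere// => /eqP ->; rewrite /= leqnn.
rewrite big_cat /= -natr1 lerD//.
rewrite (eq_big_seq (fun=> z ^+ N.+1)); last first.
  by move=> g; rewrite mem_sphere// => /eqP ->.
by rewrite big_const_seq count_predT iter_addr_0 -mulr_natl s1.
Qed.

Hypothesis r_ge2 : (2 <= r)%N.
Hypothesis G_nontrivial : forall i : 'I_r, exists x : G i, x != 1%g.

Lemma exists_other_index (k : 'I_r) : exists j : 'I_r, k != j.
Proof.
have r0 : (0 < r)%N by apply: leq_trans r_ge2.
have [k0|k0] := eqVneq (val k) 0%N.
  by exists (Ordinal r_ge2); rewrite -val_eqE k0.
by exists (Ordinal r0); rewrite -val_eqE.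
Qed.

(** If every factor has order 2, the exclusion leaves at least three factors, and letters from three
    of them serve. Otherwise some factor has two non-trivial elements, and [y] comes from another
    one. *)
Lemma exists_branching :
  ~ (r = 2%N /\ forall i : 'I_r, ([set: G i] #= `I_2)%card) ->
  exists a b y : letter G, [/\ a != b,
    [/\ tagged a != 1%g, tagged b != 1%g & tagged y != 1%g],
    tag a != tag y & tag b != tag y].
Proof.
move=> nZ2; have [all2|] := pselect (forall i : 'I_r, ([set: G i] #= `I_2)%card).
  have r2 : (2 < r)%N.
    by rewrite ltn_neqAle r_ge2 andbT; apply/eqP => r2; apply: nZ2.
  have r0 : (0 < r)%N by apply: leq_trans r2.
  have [a a1] := G_nontrivial (Ordinal r0).
  have [b b1] := G_nontrivial (Ordinal r_ge2).
  have [y y1] := G_nontrivial (Ordinal r2).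
  by exists (Tagged G a), (Tagged G b), (Tagged G y).
move=> /existsNP[k nk]; have [x x1] := G_nontrivial k.
have [x' [x'1 x'x]] : exists x', x' != 1%g /\ x' != x.
  apply: contrapT => h; apply: nk.
  have -> : [set: G k] = [set` [fset 1%g; x]%fset].
    apply/seteqP; split=> // g _ /=; rewrite !inE; apply: contrapT => ng.
    by apply: h; exists g; apply/andP; rewrite -negb_or; apply/negP.
  by apply/card_eq_fsetP; rewrite cardfs2 eq_sym x1.
have [j kj] := exists_other_index k; have [y y1] := G_nontrivial j.
exists (Tagged G x), (Tagged G x'), (Tagged G y); split=> //.
by rewrite eq_Tagged eq_sym.
Qed.

Hypothesis G_not_Z2Z2 :
  ~ (r = 2%N /\ forall i : 'I_r, ([set: G i] #= `I_2)%card).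

Lemma Omega_dim_lt (i : 'I_r) :
  (hausdorff_dim (fp_end_dist S alpha) (Omega S i) <
   hausdorff_dim (fp_end_dist S alpha) (Omega_infty S))%E.
Proof.
have /andP[a0 a1] := alpha01.
pose q m (delta : R) : R := (size (sphere S i m))%:R * (alpha `^ delta) ^+ m.
have dim_le delta m : 0 <= delta -> (0 < m)%N -> q m delta < 1 ->
    (hausdorff_dim (fp_end_dist S alpha) (Omega S i) <= delta%:E)%E.
  move=> delta0 m0 qm; apply: hausdorff_dim_le => //.
  exact: Omega_measure0 m0 qm.
(* If a sphere is empty, [q m] vanishes already at exponent 0, while two letters give the sum 2
   there and hence a positive lower bound. *)
have [[m [m0 sm]]|s_gt0] := pselect (exists m, (0 < m)%N /\ size (sphere S i m) = 0%N).
  apply: (@le_lt_trans _ _ 0%:E); first by apply: dim_le m0 _; rewrite // /q sm mul0r.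
  have [a [b [y [ab [a1' b1 y1] ay by']]]] := exists_branching G_not_Z2Z2.
  have [||||//||delta1 [d1 le]] := @Omega_infty_dim_gt [:: a; b] y 0.
  - by rewrite /= inE ab.
  - by [].
  - by move=> c; rewrite !inE => /orP[/eqP ->|/eqP ->].
  - by move=> c; rewrite !inE => /orP[/eqP ->|/eqP ->].
  - by rewrite powRr0 big_cons big_seq1 !expr1n ltrDl.
  by apply: lt_le_trans le; rewrite lte_fin.
have s1 m : (0 < m)%N -> 1 <= (size (sphere S i m))%:R :> R.
  by move=> m0; rewrite ler1n lt0n; apply/eqP => sm; apply: s_gt0; exists m.
pose D := [set delta : R | 0 <= delta /\ exists2 m, (0 < m)%N & q m delta < 1].
have D0 : lbound D 0 by move=> x [].
have hD : has_inf D.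
  split; last by exists 0.
  have a01 : 0 <= alpha < 1 by rewrite ltW.
  have sp : 0 < (size (sphere S i 1)).+1%:R^-1 :> R by rewrite invr_gt0.
  have [N /(_ N (leqnn N)) aN] := expr_lt_eventually a01 sp.
  exists N%:R; split; first by [].
  exists 1%N => //; rewrite /q powR_mulrn ?(ltW a0)// expr1.
  apply: (@le_lt_trans _ _ ((size (sphere S i 1)).+1%:R * alpha ^+ N)).
    by apply: ler_wpM2r; [exact/exprn_ge0/ltW|rewrite ler_nat].
  by rewrite -ltr_pdivlMl// mulr1.
have inf0 : 0 <= inf D by apply: lb_le_inf => //; case: hD.
(* Otherwise continuity would put a smaller exponent into [D]. There is room below [inf D], since at
   exponent 0 the value of [q m] is the size of a nonempty sphere. *)
have qinf m : (0 < m)%N -> 1 <= q m (inf D).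
  move=> m0; rewrite leNgt; apply/negP => lt1.
  have cq : q m x @[x --> inf D] --> q m (inf D).
    by apply: cvgM; [apply: cvg_cst|apply: continuous_powR_exponent].
  have ipos : 0 < inf D.
    rewrite lt_neqAle inf0 andbT; apply/eqP => i0; move: lt1.
    by rewrite -i0 /q powRr0 expr1n mulr1 ltNge s1.
  have nx : \forall x \near (inf D)^'-, [/\ x < inf D, 0 < x & q m x < 1].
    near=> x; split.
    - by near: x; apply: nbhs_left_lt.
    - by near: x; apply: nbhs_left_gt.
    near: x; apply: (cvgr_lt (F := (inf D)^'-) (f := q m) _ _ 1 lt1).
    exact: cvg_at_left_filter.
  have [x [xi x0 qx]] : exists x, [/\ x < inf D, 0 < x & q m x < 1].
    exact: filter_ex nx.
  have : inf D <= x.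
    by apply: (inf_lbound hD.2); split; [apply: ltW|exists m].
  by rewrite leNgt xi.
pose z := alpha `^ inf D; have z0 : 0 < z by apply: powR_gt0.
have [j ij] := exists_other_index i; have [g g1] := G_nontrivial j.
pose y := Tagged G g; pose ly := len (fp_inj (tagged y)).
(* [N] outweighs the factor [z ^+ ly] that the separator contributes to each summand. *)
have [N zN] : exists N : nat, z ^- ly < N%:R.
  by exists (Num.bound (z ^- ly)); apply/archi_boundP/ltW; rewrite invr_gt0 exprn_gt0.
have [F [uF FN FS]] := spheres_sum N (ltW z0) qinf.
have [||||//||delta1 [d1 le]] := @Omega_infty_dim_gt [seq Tagged G h | h <- F] y (inf D).
- by rewrite map_inj_uniq// => h k /eqP; rewrite eq_Tagged => /eqP.
- by [].
- move=> a /mapP[h /FN /andP[hl _] ->] /=; apply/eqP => h1.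
  by rewrite h1 fp_inj1 word_length1 in hl.
- by move=> a /mapP[h _ ->].
- rewrite big_map -/z.
  rewrite (eq_bigr (fun h => z ^+ len (fp_inj h) * z ^+ ly)); last first.
    by move=> h _; rewrite -exprD.
  rewrite -mulr_suml -ltr_pdivrMr ?exprn_gt0// mul1r.
  exact: lt_le_trans zN FS.
(* Since [inf D < delta1], some exponent of [D] lies below [delta1]; it separates the two
   dimensions. *)
have [delta [delta0 [m m0 qm]] dlt] := inf_lt hD.1 d1.
apply: le_lt_trans (dim_le _ _ delta0 m0 qm) _.
by apply: lt_le_trans le; rewrite lte_fin.
Unshelve. all: by end_near. Qed.

End Comparison.

Theorem corollary3p9 (R : realType) (r : nat) (G : 'I_r -> groupType)
    (S : forall i : 'I_r, set (G i)) (alpha : R)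
    (r_ge2 : (2 <= r)%N)
    (G_nontrivial : forall i : 'I_r, exists x : G i, x != 1%g)
    (G_not_Z2Z2 :
      ~ (r = 2%N /\ forall i : 'I_r, ([set: G i] #= `I_2)%card))
    (S_finite : forall i : 'I_r, finite_set (S i))
    (S_sym : forall (i : 'I_r) (x : G i), S i x -> S i (x^-1)%g)
    (S_generates : forall i : 'I_r, generates (S i))
    (S_not1 : forall i : 'I_r, ~ S i 1%g)
    (alpha01 : 0 < alpha < 1) :
  forall i : 'I_r,
    (hausdorff_dim (fp_end_dist S alpha) (Omega S i) <
     hausdorff_dim (fp_end_dist S alpha) (Omega_infty S))%E.
Proof. by move=> i; apply: Omega_dim_lt. Qed.
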